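(* Let $(\mathcal A=\mathcal T(V),\partial,\mathcal F)$ be a free, finitely generated mfDGA over $\mathbb F=\mathbb Z/2\mathbb Z$. For augmentations $\epsilon_l,\epsilon_r$ of $\mathcal A$, the spectral sequence homology groups $E^r_{p,\deg}(\epsilon_l,\epsilon_r)$, $r\ge1$, are homotopy invariants of the pair $\epsilon_l,\epsilon_r$, i.e. up to isomorphism they depend only on the chain homotopy classes of $\epsilon_l$ and $\epsilon_r$. The set of all collections of such spectral sequence homology groups (over all pairs of augmentations of $\mathcal A$) is a filtered stable tame isomorphism invariant of $(\mathcal A,\partial,\mathcal F)$.
   Context: A max-filtered DGA (mfDGA) is a unital $\mathbb Z/2\rho\mathbb Z$-graded DGA ($\deg\partial=-1$, Leibniz rule, $\partial^2=\partial1=0$) with an ascending filtration such that $\mathcal F^{\ell}\mathcal A\cdot\mathcal F^{\ell'}\mathcal A\subset\mathcal F^{\max(\ell,\ell')}\mathcal A$ and $\partial\mathcal F^\ell\mathcal A\subset\mathcal F^\ell\mathcal A$. Morphisms are degree $0$ unital filtration preserving algebra chain maps. A chain homotopy between mfDGA morphisms $\phi,\psi$ is a degree $1$ filtration preserving map $h$ with $\phi-\psi=\partial h+h\partial$ (for DGA morphisms the filtration condition is dropped). Free, finitely generated: there are finitely many homogeneous generators $a_i^\ell$ ($\ell\ge0$ the filtration level); $V$ is their span, $\mathcal F^\ell V$ the span of those of level $\le\ell$, $\mathcal A=\mathcal T(V)$, $\mathcal F^\ell\mathcal A=\mathcal T(\mathcal F^\ell V)$. An augmentation is a (degree $0$,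 unital) DGA morphism $\mathcal A\to\mathbb F$, $\mathbb F$ with zero differential. Write $\partial|_V=\sum_{k\ge0}\partial_k$ with $\partial_k:V\to V^{\otimes k}$, and $$\partial^{\epsilon_l,\epsilon_r}=\sum_{k\ge1}\Big(\sum_{i+j=k-1}\epsilon_l^{\otimes i}\otimes 1\otimes\epsilon_r^{\otimes j}\Big)\partial_k:V_*\to V_{*-1}.$$ This is a differential preserving the filtration of $V$. $E^r_{p,\deg}(\epsilon_l,\epsilon_r)$ denotes the spectral sequence of the filtered complex $(V,\partial^{\epsilon_l,\epsilon_r},\mathcal F)$, with differential on page $r$ going $E^r_{p,\deg}\to E^r_{p-r,\deg-1}$ ($p$ the filtration level, $\deg$ the homological degree). Filtered stable tame isomorphism: an elementary isomorphism of free mfDGAs is an mfDGA isomorphism sending generators $a_i\mapsto b_i$ for $i\ne j$ and $a_j\mapsto c\,b_j+v_j$, $c$ a unit, $v_j$ not involving $b_j$; a tame isomorphism is a composition of these. The $(f,\deg)$-stabilization $\mathcal S_{f,\deg}\mathcal A$ adds generators $e^f_{\deg},e^f_{\deg-1}$ of filtration level $f$ and degrees $\deg,\deg-1$, with $\partial e^f_{\deg}=e^f_{\deg-1}$, $\partial e^f_{\deg-1}=0$. Two free mfDGAs are filtered stable tame isomorphic if after finitely many stabilizations of each they are tame isomorphic.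
   Formalization: For the homotopy invariance, chain homotopies of augmentations are required to be derivations over the two augmentations, and the differential is required to strictly decrease some order on the generators; without either condition the claim is false. *)

(* Defs.v *)
From HB Require Import structures.
From mathcomp Require Import all_boot all_order all_algebra all_fingroup.
From mathcomp Require Import finmap.
From mathcomp.multinomials Require Import monalg.
From mathcomp Require Import zify.
From Stdlib Require Import Relation_Operators.

Set Implicit Arguments.
Unset Strict Implicit.
Unset Printing Implicit Defensive.

Import Order.TTheory GRing.Theory Num.Theory.
Local Open Scope ring_scope.

(* T(V), for V the F_2-vector space with basis G, is the monoid algebra of the
   free (noncommutative) monoid on G: the words of length k form a basis of the
   k-th tensor power of V. *)
Notation "''T' ( G )" := ({malg 'F_2[{fmonom G}]})
  (at level 0, format "''T' ( G )") : type_scope.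

Section TensorAlgebra.
Variable G : finType.
Implicit Types (w : {fmonom G}) (x y : 'T(G)) (U : lmodType 'F_2).

Definition letter (a : G) : 'T(G) := << fmu a >>.

Definition occurs (a : G) x : Prop :=
  exists2 w, w \in msupp x & a \in (w : seq G).

(* Degrees are integers read modulo 2 rho; rho = 0 gives Z-gradings. *)
Definition homogeneous (rho : nat) (deg : G -> int) (d : int) x : Prop :=
  forall w, w \in msupp x ->
    (\sum_(a <- w) deg a = d %[mod (2 * rho)%N])%Z.

(* x belongs to T(F^l V). *)
Definition in_filt (lev : G -> nat) (l : nat) x : Prop :=
  forall w, w \in msupp x -> all (fun a => lev a <= l)%N w.

(* The linear map given on the basis of words by h. *)
Definition lin_ext U (h : {fmonom G} -> U) x : U :=
  \sum_(w <- msupp x) x@_w *: h w.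

Lemma lin_extEw U (h : {fmonom G} -> U) (d : {fset {fmonom G}}) x :
  (msupp x `<=` d)%fset -> lin_ext h x = \sum_(w <- d) x@_w *: h w.
Proof.
move=> le; rewrite [LHS](big_fset_incl _ le) => //= w _ /mcoeff_outdom ->.
by rewrite scale0r.
Qed.

Lemma lin_ext_is_linear U (h : {fmonom G} -> U) : linear (lin_ext h).
Proof.
move=> c x y.
have lex : (msupp x `<=` msupp x `|` msupp y)%fset by rewrite fsubsetUl.
have ley : (msupp y `<=` msupp x `|` msupp y)%fset by rewrite fsubsetUr.
rewrite (lin_extEw _ lex) (lin_extEw _ ley) (@lin_extEw _ h (msupp x `|` msupp y)%fset (c *: x + y)).
  rewrite scaler_sumr -big_split /=; apply: eq_bigr => w _.
  by rewrite mcoeffD mcoeffZ scalerDl scalerA.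
by apply: fsubset_trans (msuppD_le _ _) _; rewrite fsetSU // msuppZ_le.
Qed.

HB.instance Definition _ U (h : {fmonom G} -> U) :=
  GRing.isLinear.Build 'F_2 'T(G) U _ (lin_ext h) (lin_ext_is_linear h).

Lemma lin_ext_word U (h : {fmonom G} -> U) w : lin_ext h << w >> = h w.
Proof. by rewrite /lin_ext msuppU1 big_seq_fset1 mcoeffUU scale1r. Qed.

Lemma wordZ (c : 'F_2) w : << c *g w >> = c *: << w >> :> 'T(G).
Proof. by apply/malgP => v; rewrite mcoeffZ mcoeffU mcoeffU1 mulr_natr. Qed.

Lemma tensor_ind (P : 'T(G) -> Prop) : P 0 ->
  (forall c w x, P x -> P (c *: << w >> + x)) -> forall x, P x.
Proof.
move=> P0 PD x; rewrite (monalgE x); elim: (enum_fset _) => [|w s IH].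
  by rewrite big_nil.
by rewrite big_cons wordZ; apply: PD.
Qed.

Lemma eq_lin_ext U (f g : {linear 'T(G) -> U}) :
  (forall w, f << w >> = g << w >>) -> f =1 g.
Proof.
move=> fg; elim/tensor_ind => [|c w x IH]; first by rewrite !linear0.
by rewrite !linearP fg IH.
Qed.

Lemma wordM w w' : << w >> * << w' >> = << (mul w w') >> :> 'T(G).
Proof. by rewrite malgM_def fgmulUU mulr1. Qed.

Lemma homogeneous0 rho deg d : homogeneous rho deg d 0.
Proof. by move=> w; rewrite msupp0. Qed.

Lemma homogeneousD rho deg d x y : homogeneous rho deg d x ->
  homogeneous rho deg d y -> homogeneous rho deg d (x + y).
Proof.
move=> hx hy w /(fsubsetP (msuppD_le x y)).
by rewrite in_fsetU => /orP[/hx|/hy].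
Qed.

Lemma homogeneousZ rho deg d c x : homogeneous rho deg d x ->
  homogeneous rho deg d (c *: x).
Proof. by move=> hx w /(fsubsetP (msuppZ_le c x)) /hx. Qed.

Lemma homogeneousM rho deg d d' x y : homogeneous rho deg d x ->
  homogeneous rho deg d' y -> homogeneous rho deg (d + d') (x * y).
Proof.
move=> hx hy w /msuppM_le[u [v [/hx hu /hy hv ->]]].
rewrite fmM big_cat /= -[LHS]modzDm -[RHS]modzDm.
by rewrite hu hv.
Qed.

Lemma homogeneous_mod rho deg d d' x : (d = d' %[mod (2 * rho)%N])%Z ->
  homogeneous rho deg d x -> homogeneous rho deg d' x.
Proof. by move=> dd hx w /hx ->. Qed.

Lemma homogeneous_word rho deg w :
  homogeneous rho deg (\sum_(a <- w) deg a) << w >>.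
Proof. by move=> v; rewrite msuppU1 in_fset1 => /eqP->. Qed.

Lemma in_filt0 lev l : in_filt lev l 0.
Proof. by move=> w; rewrite msupp0. Qed.

Lemma in_filtD lev l x y :
  in_filt lev l x -> in_filt lev l y -> in_filt lev l (x + y).
Proof.
move=> hx hy w /(fsubsetP (msuppD_le x y)).
by rewrite in_fsetU => /orP[/hx|/hy].
Qed.

Lemma in_filtZ lev l c x : in_filt lev l x -> in_filt lev l (c *: x).
Proof. by move=> hx w /(fsubsetP (msuppZ_le c x)) /hx. Qed.

Lemma in_filtS lev l l' x : (l <= l')%N -> in_filt lev l x -> in_filt lev l' x.
Proof.
by move=> ll' hx w /hx; apply: sub_all => a; move/leq_trans; apply.
Qed.

Lemma in_filtM lev l l' x y : in_filt lev l x -> in_filt lev l' y ->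
  in_filt lev (maxn l l') (x * y).
Proof.
move=> /(in_filtS (leq_maxl l l')) hx /(in_filtS (leq_maxr l l')) hy w.
by case/msuppM_le => u [v [/hx hu /hy hv ->]]; rewrite fmM all_cat hu.
Qed.

Lemma in_filt_word lev l w :
  all (fun a => lev a <= l)%N w -> in_filt lev l << w >>.
Proof. by move=> hw v; rewrite msuppU1 in_fset1 => /eqP->. Qed.

(* The derivation of T(V) extending f (no signs in characteristic 2). *)
Fixpoint der_seq (f : G -> 'T(G)) (s : seq G) : 'T(G) :=
  if s is a :: s' then f a * << FMonom s' >> + letter a * der_seq f s' else 0.

Definition der (f : G -> 'T(G)) : 'T(G) -> 'T(G) :=
  lin_ext (fun w => der_seq f w).

HB.instance Definition _ f := GRing.Linear.on (der f).

End TensorAlgebra.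

Section Derivation.
Variable G : finType.
Implicit Types (w : {fmonom G}) (x y : 'T(G)) (f : G -> 'T(G)).

Lemma scale_mulr c x y : x * (c *: y) = c *: (x * y).
Proof. by case: c => [[|[|//]] ?]; rewrite -[Ordinal _]natr_Zp ?scale0r ?mulr0 ?scale1r. Qed.

Lemma word_cat (s t : seq G) :
  << FMonom (s ++ t) >> = << FMonom s >> * << FMonom t >> :> 'T(G).
Proof.
have -> : FMonom (s ++ t) = mul (FMonom s) (FMonom t).
  by apply/eqP; rewrite fmP fmM.
by rewrite wordM.
Qed.

Lemma word_cons a (s : seq G) :
  << FMonom (a :: s) >> = letter a * << FMonom s >> :> 'T(G).
Proof. by rewrite -cat1s word_cat /letter fmuE. Qed.

Lemma word_nil : << FMonom [::] >> = 1 :> 'T(G).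
Proof. by rewrite -fmoneE. Qed.

Lemma der_word f w : der f << w >> = der_seq f w.
Proof. exact: lin_ext_word. Qed.

Lemma der_letter f a : der f (letter a) = f a.
Proof. by rewrite der_word fmU /= mulr0 addr0 word_nil mulr1. Qed.

Lemma der1 f : der f 1 = 0.
Proof. by rewrite (der_word f mone) fm1. Qed.

Lemma der_seq_cat f (s t : seq G) : der_seq f (s ++ t) =
  der_seq f s * << FMonom t >> + << FMonom s >> * der_seq f t.
Proof.
elim: s => [|a s IH]; first by rewrite word_nil mul0r add0r mul1r.
rewrite cat_cons word_cons /= IH word_cat.
have aux (R : pzRingType) (p q u v y z : R) :
  p * (y * z) + u * (q * z + y * v) = (p * y + u * q) * z + u * y * v.
  by rewrite mulrDr mulrDl !mulrA addrA.
exact: aux.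
Qed.

Lemma derM f x y : der f (x * y) = der f x * y + x * der f y.
Proof.
have stepl (A : lalgType 'F_2) (D : {linear A -> A}) c (u z t : A) :
    D (u * t) = D u * t + u * D t -> D (z * t) = D z * t + z * D t ->
    D ((c *: u + z) * t) = D (c *: u + z) * t + (c *: u + z) * D t.
  move=> Du Dz; rewrite mulrDl !linearD /= Dz !mulrDl addrACA; congr (_ + _).
  by rewrite -!scalerAl !linearZ /= -scalerAl -scalerDr Du.
have stepr (A : lalgType 'F_2) (D : {linear A -> A}) c (t u z : A) :
    (forall a b : A, b * (c *: a) = c *: (b * a)) ->
    D (t * u) = D t * u + t * D u -> D (t * z) = D t * z + t * D z ->
    D (t * (c *: u + z)) = D t * (c *: u + z) + t * D (c *: u + z).
  move=> cC Du Dz; rewrite mulrDr !linearD /= Dz !mulrDr addrACA; congr (_ + _).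
  have DZ a : D (c *: a) = c *: D a by exact: linearZZ.
  by rewrite !(cC, DZ) -scalerDr Du.
elim/tensor_ind: x => [|c u x IHx].
  by rewrite mul0r linear0 mul0r mul0r addr0.
apply: stepl IHx; elim/tensor_ind: y => [|c' v y IHy].
  by rewrite mulr0 linear0 mulr0 mulr0 addr0.
apply: stepr IHy => [a b|]; first exact: scale_mulr.
case: u v => [s] [t].
by rewrite /= -word_cat !der_word; apply: der_seq_cat.
Qed.

End Derivation.

Lemma addxx (U : lmodType 'F_2) (u : U) : u + u = 0.
Proof. by rewrite -mulr2n -scaler_nat pchar_Fp_0 ?scale0r. Qed.

Lemma lin_ext_closed (G : finType) (U : lmodType 'F_2) (Q : U -> Prop)
    (h : {fmonom G} -> U) (x : 'T(G)) :
  Q 0 -> (forall u v, Q u -> Q v -> Q (u + v)) ->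
  (forall c u, Q u -> Q (c *: u)) ->
  (forall w, w \in msupp x -> Q (h w)) -> Q (lin_ext h x).
Proof.
move=> Q0 QD QZ Qh; rewrite /lin_ext big_seq; apply: big_ind => // w wx.
by apply: QZ; apply: Qh.
Qed.

Section DerivationGrading.
Variables (G : finType) (rho : nat) (deg : G -> int) (lev : G -> nat).
Variable f : G -> 'T(G).
Hypothesis f_deg : forall a, homogeneous rho deg (deg a - 1) (f a).
Hypothesis f_lev : forall a, in_filt lev (lev a) (f a).

Lemma homogeneous_der d x :
  homogeneous rho deg d x -> homogeneous rho deg (d - 1) (der f x).
Proof.
move=> hx; apply: lin_ext_closed => [||c u|w /hx wd].
- exact: homogeneous0.
- exact: homogeneousD.
- exact: homogeneousZ.
apply: (@homogeneous_mod _ _ _ (\sum_(a <- w) deg a - 1)).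
  by rewrite -[LHS]modzDml wd modzDml.
move: w {wd} => [s] /=; elim: s => [|a s IH] /=; first exact: homogeneous0.
rewrite big_cons; apply: homogeneousD.
  rewrite addrAC; apply: homogeneousM => //.
  exact: (@homogeneous_word _ _ _ (FMonom s)).
rewrite -addrA; apply: homogeneousM => //.
by have := @homogeneous_word _ rho deg (fmu a); rewrite fmU big_seq1.
Qed.

Lemma in_filt_der l x : in_filt lev l x -> in_filt lev l (der f x).
Proof.
move=> hx; apply: lin_ext_closed => [||c u|[s] /hx /=].
- exact: in_filt0.
- exact: in_filtD.
- exact: in_filtZ.
elim: s => [|a s IH] /=; first by move=> _; apply: in_filt0.
case/andP => al sl; apply: in_filtD; rewrite -[l]maxnn; apply: in_filtM.
- exact: in_filtS al _.
- exact: in_filt_word.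
- by apply: in_filt_word; rewrite fmU /= al.
- exact: IH.
Qed.

Lemma der_sq : (forall a, der f (f a) = 0) -> forall x, der f (der f x) = 0.
Proof.
move=> ff; apply: (@eq_lin_ext _ _ (der f \o der f) \0) => -[s] /=.
elim: s => [|a s IH]; first by rewrite word_nil der1 linear0.
rewrite word_cons derM linearD /= !derM der_letter ff IH mul0r add0r mulr0 addr0.
exact: addxx.
Qed.

End DerivationGrading.

(* Free, finitely generated max-filtered DGAs over F_2: A = T(V), with V
   spanned by gen, and F^l A = T(F^l V).  That F^l A F^l' A lies in
   F^(max l l') A is in_filtM. *)
Record mfDGA (rho : nat) := MfDGA {
  gen : finType;
  gdeg : gen -> int;
  glev : gen -> nat;
  diff : {linear 'T(gen) -> 'T(gen)};
  diff_deg : forall d x,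
    homogeneous rho gdeg d x -> homogeneous rho gdeg (d - 1) (diff x);
  diff1 : diff 1 = 0;
  diffM : forall x y, diff (x * y) = diff x * y + x * diff y;
  diffK : forall x, diff (diff x) = 0;
  diff_filt : forall l x, in_filt glev l x -> in_filt glev l (diff x) }.

Notation alg A := 'T(gen A).

Section Stabilization.
Variables (rho : nat) (A : mfDGA rho) (f : nat) (d : int).
Let S : finType := (gen A + bool)%type.

Definition stab_incl : alg A -> 'T(S) :=
  lin_ext (fun w : {fmonom gen A} => << FMonom [seq inl a | a <- w] >>).

HB.instance Definition _ := GRing.Linear.on stab_incl.

(* inr true and inr false are the new generators of degree d and d - 1. *)
Definition stab_deg (a : S) : int :=
  match a with inl a => gdeg a | inr true => d | inr false => d - 1 end.

Definition stab_lev (a : S) : nat := if a is inl a then glev a else f.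

Definition stab_gdiff (a : S) : 'T(S) :=
  match a with
  | inl a => stab_incl (diff A (letter a))
  | inr true => letter (inr false)
  | inr false => 0
  end.

Lemma stab_incl_word (s : seq (gen A)) :
  stab_incl << FMonom s >> = << FMonom [seq inl a | a <- s] >>.
Proof. exact: lin_ext_word. Qed.

Lemma stab_inclM (x y : alg A) :
  stab_incl (x * y) = stab_incl x * stab_incl y.
Proof.
have stepl (B C : lalgType 'F_2) (D : {linear B -> C}) c (u z t : B) :
    D (u * t) = D u * D t -> D (z * t) = D z * D t ->
    D ((c *: u + z) * t) = D (c *: u + z) * D t.
  move=> Du Dz; rewrite mulrDl !linearD /= Dz mulrDl; congr (_ + _).
  by rewrite -scalerAl !linearZ /= -scalerAl Du.
have stepr (B C : lalgType 'F_2) (D : {linear B -> C}) c (t u z : B) :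
    (forall a b : B, b * (c *: a) = c *: (b * a)) ->
    (forall a b : C, b * (c *: a) = c *: (b * a)) ->
    D (t * u) = D t * D u -> D (t * z) = D t * D z ->
    D (t * (c *: u + z)) = D t * D (c *: u + z).
  move=> cB cC Du Dz; rewrite mulrDr !linearD /= Dz mulrDr; congr (_ + _).
  by rewrite cB linearZZ linearZZ cC Du.
elim/tensor_ind: x => [|c u x IHx]; first by rewrite mul0r linear0 mul0r.
apply: stepl IHx; elim/tensor_ind: y => [|c' v y IHy].
  by rewrite mulr0 linear0 mulr0.
apply: stepr IHy => [a b|a b|]; [exact: scale_mulr|exact: scale_mulr|].
case: u v => [s] [t].
by rewrite /= -word_cat !stab_incl_word map_cat word_cat.
Qed.

Lemma der_stab_incl (x : alg A) :
  der stab_gdiff (stab_incl x) = stab_incl (diff A x).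
Proof.
move: x; apply: (@eq_lin_ext _ _ (der stab_gdiff \o stab_incl)
  (stab_incl \o diff A)) => -[s] /=.
elim: s => [|a s IH].
  by rewrite stab_incl_word /= !word_nil der1 diff1 linear0.
have ia : stab_incl (letter a) = letter (inl a).
  by rewrite /letter fmuE stab_incl_word fmuE.
rewrite word_cons stab_inclM derM IH ia der_letter diffM.
have DD (u v : alg A) : stab_incl (u + v) = stab_incl u + stab_incl v.
  exact: (linearD stab_incl).
by rewrite DD !stab_inclM ia.
Qed.

Definition stab_diff : 'T(S) -> 'T(S) := der stab_gdiff.

HB.instance Definition _ := GRing.Linear.on stab_diff.

Lemma stab_gdiff_deg (a : S) :
  homogeneous rho stab_deg (stab_deg a - 1) (stab_gdiff a).
Proof.
case: a => [a|[]] /=; last exact: homogeneous0.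
  have := @homogeneous_word _ rho (@gdeg _ A) (fmu a).
  rewrite fmU big_seq1 => /diff_deg; rewrite -/(letter a).
  move: (diff A _) => x hx.
  apply: lin_ext_closed => [||c u|w /hx wd].
  - exact: homogeneous0.
  - exact: homogeneousD.
  - exact: homogeneousZ.
  apply: homogeneous_mod (@homogeneous_word _ rho stab_deg _).
  by rewrite /= big_map.
have := @homogeneous_word _ rho stab_deg (fmu (inr false : S)).
by rewrite fmU big_seq1.
Qed.

Lemma stab_gdiff_lev (a : S) :
  in_filt stab_lev (stab_lev a) (stab_gdiff a).
Proof.
case: a => [a|[]] /=; last exact: in_filt0.
  have : in_filt (@glev _ A) (glev a) (letter a).
    by apply: in_filt_word; rewrite fmU /= leqnn.
  move=> /diff_filt; move: (diff A _) => x hx.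
  apply: lin_ext_closed => [||c u|w /hx wd].
  - exact: in_filt0.
  - exact: in_filtD.
  - exact: in_filtZ.
  by apply: in_filt_word; rewrite /= all_map.
by apply: in_filt_word; rewrite fmU /= leqnn.
Qed.

Lemma stab_diffK x : stab_diff (stab_diff x) = 0.
Proof.
apply: der_sq => -[a|[]] /=.
- by rewrite der_stab_incl diffK linear0.
- by rewrite der_letter.
- exact: linear0.
Qed.

Definition stab : mfDGA rho :=
  @MfDGA rho S stab_deg stab_lev stab_diff
    (homogeneous_der stab_gdiff_deg) (der1 stab_gdiff) (derM stab_gdiff)
    stab_diffK (in_filt_der stab_gdiff_lev).

End Stabilization.

Record augmentation (rho : nat) (A : mfDGA rho) := Augmentation {
  aug :> {lrmorphism alg A -> 'F_2 | *%R};
  aug_deg : forall d x, homogeneous rho (@gdeg _ A) d x ->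
    (d <> 0 %[mod (2 * rho)%N])%Z -> aug x = 0;
  aug_diff : forall x, aug (diff A x) = 0 }.

(* The coordinate space V; ('F_2)^o is 'F_2 as a module over itself. *)
Notation vect A := {ffun gen A -> ('F_2)^o}.

HB.instance Definition _ (G : finType) :=
  GRing.Zmodule.on {ffun G -> ('F_2)^o}.

HB.instance Definition _ (G : finType) :=
  [finGroupMixin of {ffun G -> ('F_2)^o} for +%R].

Section BilinearizedDifferential.
Variables (rho : nat) (A : mfDGA rho) (el er : augmentation A).

Definition basis (a : gen A) : vect A := [ffun b => (b == a)%:R].

(* On a word w of length k, the sum over i + j = k - 1 of
   el^(x)i (x) 1 (x) er^(x)j; it is 0 on the empty word. *)
Definition bilin_word (w : {fmonom gen A}) : vect A :=
  \sum_(i < size w)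
    ((\prod_(a <- take i w) el (letter a)) *
     (\prod_(a <- drop i.+1 w) er (letter a))) *:
    basis (tnth (in_tuple w) i).

Definition bdiff (v : vect A) : vect A :=
  \sum_a v a *: lin_ext bilin_word (diff A (letter a)).

Lemma bdiff_is_linear : linear bdiff.
Proof.
move=> c u v; rewrite scaler_sumr -big_split; apply: eq_bigr => a _ /=.
by rewrite !ffunE scalerDl scalerA.
Qed.

HB.instance Definition _ :=
  GRing.isLinear.Build 'F_2 (vect A) (vect A) _ bdiff bdiff_is_linear.

Lemma bdiff0 : bdiff 0 = 0. Proof. exact: linear0. Qed.

Lemma bdiffD u v : bdiff (u + v) = bdiff u + bdiff v.
Proof. exact: (linearD bdiff). Qed.

(* Filtration indices of V are integers, so that F^p V = 0 for p < 0. *)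
Definition filtV (p : int) (v : vect A) : bool :=
  [forall a, (v a != 0) ==> ((glev a)%:Z <= p)].

Definition degV (d : int) (v : vect A) : bool :=
  [forall a, (v a != 0) ==> (gdeg a == d %[mod (2 * rho)%N])%Z].

(* Z^r_{p,d} = {v in F^p V_d | bdiff v in F^(p - r) V}. *)
Definition Zcyc (r p d : int) : {set vect A} :=
  [set v | [&& filtV p v, degV d v & filtV (p - r) (bdiff v)]].

(* Z^{r-1}_{p-1,d} + bdiff (Z^{r-1}_{p+r-1,d+1}). *)
Definition Bbnd (r p d : int) : {set vect A} :=
  [set (u : vect A) + bdiff v | u in Zcyc (r - 1) (p - 1) d,
                                  v in Zcyc (r - 1) (p + r - 1) (d + 1)].

Lemma filtV0 p : filtV p 0.
Proof. by apply/forallP => a; rewrite ffunE eqxx. Qed.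

Lemma filtVD p u v : filtV p u -> filtV p v -> filtV p (u + v).
Proof.
move=> /forallP hu /forallP hv; apply/forallP => a; apply/implyP.
rewrite ffunE; have [->|un _] := eqVneq (u a) 0; last exact: implyP (hu a) un.
by rewrite add0r => /(implyP (hv a)).
Qed.

Lemma degV0 d : degV d 0.
Proof. by apply/forallP => a; rewrite ffunE eqxx. Qed.

Lemma degVD d u v : degV d u -> degV d v -> degV d (u + v).
Proof.
move=> /forallP hu /forallP hv; apply/forallP => a; apply/implyP.
rewrite ffunE; have [->|un _] := eqVneq (u a) 0; last exact: implyP (hu a) un.
by rewrite add0r => /(implyP (hv a)).
Qed.

Lemma Zcyc_group_set r p d : group_set (Zcyc r p d).
Proof.
apply/group_setP; split=> [|u v].
  by rewrite inE FinRing.zmod1gE filtV0 degV0 bdiff0 filtV0.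
rewrite !inE FinRing.zmodMgE => /and3P[u1 u2 u3] /and3P[v1 v2 v3].
by rewrite bdiffD !filtVD ?degVD.
Qed.

Canonical Zcyc_group r p d := Group (Zcyc_group_set r p d).

Lemma Bbnd_group_set r p d : group_set (Bbnd r p d).
Proof.
apply/group_setP; split=> [|x y].
  apply/imset2P; exists (1%g : vect A) (1%g : vect A); rewrite ?group1 //.
  by rewrite FinRing.zmod1gE bdiff0 addr0.
case/imset2P=> u v hu hv -> /imset2P[u' v' hu' hv' ->]; apply/imset2P.
exists (u * u')%g (v * v')%g; rewrite ?groupM //.
by rewrite !FinRing.zmodMgE bdiffD addrACA.
Qed.

Canonical Bbnd_group r p d := Group (Bbnd_group_set r p d).

(* E^r_{p,d}, as a group; homomorphisms of F_2-vector spaces are the same as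
   homomorphisms of the underlying groups. *)
Definition page (r : nat) (p d : int) :=
  (Zcyc r%:Z p d / Bbnd r%:Z p d)%G.

End BilinearizedDifferential.

(* The pairs (el, er) and (el', er') have isomorphic collections of groups
   E^r_{p,d}, r >= 1. *)
Definition same_pages (rho : nat) (A B : mfDGA rho)
    (el er : augmentation A) (el' er' : augmentation B) : Prop :=
  forall (r : nat) (p d : int), (1 <= r)%N ->
    page el er r p d \isog page el' er' r p d.

(* The sets of isomorphism classes of collections of groups E^r_{p,d}, r >= 1,
   over all pairs of augmentations of A and of B coincide. *)
Definition same_page_collections (rho : nat) (A B : mfDGA rho) : Prop :=
  (forall el er : augmentation A, exists el' er' : augmentation B,
     same_pages el er el' er') /\
  (forall el' er' : augmentation B, exists el er : augmentation A,
     same_pages el er el' er').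

Definition mf_morphism (rho : nat) (A B : mfDGA rho)
    (phi : {lrmorphism alg A -> alg B}) : Prop :=
  [/\ forall d x, homogeneous rho (@gdeg _ A) d x ->
        homogeneous rho (@gdeg _ B) d (phi x),
      forall l x, in_filt (@glev _ A) l x -> in_filt (@glev _ B) l (phi x)
    & forall x, phi (diff A x) = diff B (phi x)].

Definition mf_isomorphism (rho : nat) (A B : mfDGA rho)
    (phi : {lrmorphism alg A -> alg B}) : Prop :=
  mf_morphism phi /\
  exists psi : {lrmorphism alg B -> alg A},
    [/\ mf_morphism psi, cancel phi psi & cancel psi phi].

(* sigma matches the indices of the generators: b_i = sigma a_i. *)
Definition elementary_iso (rho : nat) (A B : mfDGA rho) : Prop :=
  exists (phi : {lrmorphism alg A -> alg B}) (sigma : gen A -> gen B)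
      (j : gen A) (c : 'F_2) (v : alg B),
    [/\ mf_isomorphism phi, bijective sigma,
        forall i, i != j -> phi (letter i) = letter (sigma i),
        phi (letter j) = c *: letter (sigma j) + v
      & c \is a GRing.unit /\ ~ occurs (sigma j) v].

Definition tame_iso (rho : nat) : mfDGA rho -> mfDGA rho -> Prop :=
  clos_refl_trans _ (@elementary_iso rho).

Definition stabs (rho : nat) (A : mfDGA rho) (s : seq (nat * int)) :
  mfDGA rho := foldl (fun B fd => stab B fd.1 fd.2) A s.

Definition stable_tame_iso (rho : nat) (A B : mfDGA rho) : Prop :=
  exists s t : seq (nat * int), tame_iso (stabs A s) (stabs B t).

(* Chain homotopy of augmentations as DGA morphisms: a degree 1 map h with
   el - el' = h o diff (the differential of F_2 is 0) which is an
   (el, el')-derivation, as is usual for DGA morphisms.  Without the derivation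
   rule the relation only says that el and el' induce the same map on
   homology, and the homology of (V, bdiff) is not an invariant of that: take
   diff a = c x, diff w = x y, diff b = a y + c w, other generators closed,
   and el, el' nonzero at most on a. *)
Definition homotopic (rho : nat) (A : mfDGA rho) (el el' : augmentation A) :
  Prop :=
  exists h : {linear alg A -> 'F_2 | *%R},
    [/\ forall d x, homogeneous rho (@gdeg _ A) d x ->
          (d + 1 <> 0 %[mod (2 * rho)%N])%Z -> h x = 0,
        forall x y, h (x * y) = h x * el' y + el x * h y
      & forall x, el x - el' x = h (diff A x)].

(* Some order on the generators is strictly decreased by diff, as the action
   (height) is for Legendrian DGAs.  Otherwise homotopic augmentations can have
   different homologies: take generators e_ij, i, j in {0, 1}, with
   diff e_ij = e_i0 e_0j + e_i1 e_1j and deg e_ij = j - i - 1; the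
   augmentations nonzero at most on e_01 are all homotopic, by
   h e_00 = h e_11 = 1. *)
Definition triangular (rho : nat) (A : mfDGA rho) : Prop :=
  exists ht : gen A -> nat,
    forall a b, occurs b (diff A (letter a)) -> (ht b < ht a)%N.

(* Main.v *)
Require Import Defs.
From HB Require Import structures.
From mathcomp Require Import all_boot all_order all_algebra all_fingroup.
From mathcomp Require Import finmap.
From mathcomp.multinomials Require Import monalg.
From mathcomp Require Import zify.

(** Notation: el, er are augmentations, d is the differential of T(V), and for
    functionals phi, psi on T(V) the map contract phi psi : T(V) -> V sends a
    word to the sum, over its letters b, of phi(prefix) psi(suffix) b.

    Everything follows from the behaviour of these contractions.  The map
    D = contract el er is the identity on V and satisfies
    D(xy) = D(x) er(y) + el(x) D(y); the bilinearized differential is D o d on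
    V.  As el and er vanish on boundaries, D o d = bdiff o D on all of T(V)
    (aug_contract_diff).

    Homotopy invariance.  Let h be an (er, er')-derivation with
    er - er' = h o d, and let T = contract el h o d on V.  The same induction on
    words gives
      contract el h o d = T o D' + bdiff o contract el h + (D - D'),
    where D' belongs to (el, er') and bdiff to (el, er)
    (right_homotopy_diff).  On boundaries the left side vanishes, so 1 + T is a
    chain map from the complex of (el, er') to the complex of (el, er).  It
    preserves levels and degrees; a height function that d strictly decreases
    is strictly decreased by T, so 1 + T is injective, hence bijective because
    V is finite, and its inverse is one of its own iterates at each vector, so
    it preserves levels and degrees as well.  A homotopy of left augmentations
    is treated symmetrically (left_homotopy_diff), and the two steps compose.

    Stable tame invariance.  A morphism F : A -> B induces the chain map
    a |-> contract el er (F a) from the complex of (el o F, er o F) to that of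
    (el, er), functorially in F (contract_natural), so isomorphic mfDGAs have
    the same collections of pages; pulling augmentations back along F and its
    inverse matches the pairs.  A stabilization adds two basis vectors x, y of
    one level with bdiff x = y, whatever values the augmentations take on x and
    y, because d x = y is a single letter.  The old complex is then a
    filtered deformation retract of the new one (same_pages_acyclic), and
    pages from the first on are invariant under such retractions
    (same_pages_retract). *)

Set Implicit Arguments.
Unset Strict Implicit.
Unset Printing Implicit Defensive.

Import Order.TTheory GRing.Theory Num.Theory.
Local Open Scope ring_scope.

Local Notation word s := << FMonom s >>.

(** * Additive maps on a ring spanned by words *)

Section SpanInduction.
Variables (S : Type) (R U : zmodType) (wd : S -> R).
Hypothesis span : forall P : R -> Prop, P 0 ->
  (forall s x, P x -> P (wd s + x)) -> forall x, P x.

Lemma eq_additive (f g : R -> U) :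
  {morph f : x y / x + y} -> {morph g : x y / x + y} ->
  (forall s, f (wd s) = g (wd s)) -> f =1 g.
Proof.
move=> fD gD fg; elim/span => [|s x IH]; last by rewrite fD gD fg IH.
by rewrite -[f 0](addrK (f 0)) -[g 0](addrK (g 0)) -fD -gD !addr0 !subrr.
Qed.

Lemma eq_biadditive (f g : R -> R -> U) :
  (forall y, {morph f^~ y : x x' / x + x'}) ->
  (forall x, {morph f x : y y' / y + y'}) ->
  (forall y, {morph g^~ y : x x' / x + x'}) ->
  (forall x, {morph g x : y y' / y + y'}) ->
  (forall s t, f (wd s) (wd t) = g (wd s) (wd t)) -> f =2 g.
Proof.
move=> fD fD' gD gD' fg x y.
apply: (@eq_additive (f^~ y) (g^~ y)) => // s.
exact: (@eq_additive (f (wd s)) (g (wd s))).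
Qed.

End SpanInduction.

(** * Contracting words with a pair of functionals *)

(** R stands for T(V), a ring spanned by the products wd s of the generators
    gn a, and V for the module containing the vectors e a that the generators
    correspond to. *)

Section ContractSeq.
Variables (G : Type) (R : pzRingType) (gn : G -> R) (wd : seq G -> R).
Hypothesis wd_nil : wd [::] = 1.
Hypothesis wd_cons : forall a s, wd (a :: s) = gn a * wd s.
Variables (K : comPzRingType) (V : lmodType K) (e : G -> V).
Implicit Types (phi psi : R -> K) (x y : R) (s t : seq G).

(** The recursion absorbs the letters already passed into the left functional,
    which avoids indexing the positions of a word. *)
Fixpoint contract_seq phi psi s : V :=
  if s is a :: s' then
    (phi 1 * psi (wd s')) *: e a
    + contract_seq (fun x => phi (gn a * x)) psi s'
  else 0.

Lemma wd_cat s t : wd (s ++ t) = wd s * wd t.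
Proof.
by elim: s => [|a s IH] /=; rewrite ?wd_nil ?mul1r // !wd_cons IH mulrA.
Qed.

Lemma eq_contract_seq phi phi' psi psi' s : phi =1 phi' -> psi =1 psi' ->
  contract_seq phi psi s = contract_seq phi' psi' s.
Proof.
elim: s phi phi' => //= a s IH phi phi' E E'.
by rewrite E E' (IH _ (fun x => phi' (gn a * x))).
Qed.

Lemma contract_seqDl phi phi' psi s :
  contract_seq (fun x => phi x + phi' x) psi s =
  contract_seq phi psi s + contract_seq phi' psi s.
Proof.
elim: s phi phi' => [|a s IH] phi phi' /=; first by rewrite addr0.
by rewrite IH mulrDl scalerDl addrACA.
Qed.

Lemma contract_seqDr phi psi psi' s :
  contract_seq phi (fun x => psi x + psi' x) s =
  contract_seq phi psi s + contract_seq phi psi' s.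
Proof.
elim: s phi => [|a s IH] phi /=; first by rewrite addr0.
by rewrite IH mulrDr scalerDl addrACA.
Qed.

Lemma contract_seqZl c phi psi s :
  contract_seq (fun x => c * phi x) psi s = c *: contract_seq phi psi s.
Proof.
elim: s phi => [|a s IH] phi /=; first by rewrite scaler0.
by rewrite IH scalerDr scalerA mulrA.
Qed.

Lemma contract_seqZr c phi psi s :
  contract_seq phi (fun x => psi x * c) s = c *: contract_seq phi psi s.
Proof.
elim: s phi => [|a s IH] phi /=; first by rewrite scaler0.
by rewrite IH scalerDr scalerA mulrA mulrC.
Qed.

(** The marked letter lies in s or in t, and the other word joins the suffix or
    the prefix.  All product rules are specializations of this one. *)
Lemma contract_seq_cat phi psi s t : contract_seq phi psi (s ++ t) =
  contract_seq phi (fun x => psi (x * wd t)) s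
  + contract_seq (fun x => phi (wd s * x)) psi t.
Proof.
elim: s phi => [|a s IH] phi /=.
  by rewrite add0r; apply: eq_contract_seq => // x; rewrite wd_nil mul1r.
rewrite IH wd_cat addrA; congr (_ + _).
by apply: eq_contract_seq => // x; rewrite wd_cons mulrA.
Qed.

(** For multiplicative functionals the recursion unfolds to the usual sum over
    positions, with the values on prefixes and suffixes expanded letterwise. *)
Lemma contract_seq_sum (el er : {rmorphism R -> K}) s :
  contract_seq el er s = \sum_(i < size s)
    ((\prod_(a <- take i s) el (gn a)) * (\prod_(a <- drop i.+1 s) er (gn a)))
    *: e (tnth (in_tuple s) i).
Proof.
(* The scalar c collects the values of el on the letters already passed. *)
suff H c : contract_seq (fun x => c * el x) er s =
    \sum_(i < size s) ((c * \prod_(a <- take i s) el (gn a)) *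
     (\prod_(a <- drop i.+1 s) er (gn a))) *: e (tnth (in_tuple s) i).
  have := H 1; rewrite contract_seqZl scale1r => ->.
  by apply: eq_bigr => i _; rewrite mul1r.
have erw t : er (wd t) = \prod_(a <- t) er (gn a).
  elim: t => [|a t IH]; first by rewrite wd_nil rmorph1 big_nil.
  by rewrite wd_cons rmorphM IH big_cons.
elim: s c => [|a s IH] c; first by rewrite big_ord0.
rewrite big_ord_recl /= big_nil drop0 mulr1 rmorph1 mulr1 erw.
have -> : tnth (in_tuple (a :: s)) ord0 = a by rewrite (tnth_nth a).
congr (_ + _).
rewrite (@eq_contract_seq _ (fun x => c * el (gn a) * el x) _ er) //;
  last by move=> x; rewrite rmorphM mulrA.
rewrite IH; apply: eq_bigr => i _.
rewrite big_cons mulrA; congr (_ *: e _).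
by rewrite !(tnth_nth a).
Qed.

Lemma contract_seq_support (P : V -> Prop) phi psi s :
  P 0 -> (forall u v, P u -> P v -> P (u + v)) ->
  (forall p a q, s = p ++ a :: q -> P ((phi (wd p) * psi (wd q)) *: e a)) ->
  P (contract_seq phi psi s).
Proof.
move=> P0 PD; elim: s phi => //= a s IH phi Ps; apply: PD.
  by rewrite -wd_nil; apply: (Ps [::]).
by apply: IH => p b q E; rewrite -wd_cons; apply: (Ps (a :: p)); rewrite E.
Qed.

End ContractSeq.

(** * Contractions and the differential *)

(** C stands for the additive extension of contract_seq from words to R. *)

Section Contraction.
Variables (G : Type) (R : pzRingType) (gn : G -> R) (wd : seq G -> R).
Hypothesis wd_nil : wd [::] = 1.
Hypothesis wd_cons : forall a s, wd (a :: s) = gn a * wd s.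
Hypothesis span : forall P : R -> Prop, P 0 ->
  (forall s x, P x -> P (wd s + x)) -> forall x, P x.
Variables (K : comPzRingType) (V : lmodType K) (e : G -> V).
Variable C : (R -> K) -> (R -> K) -> R -> V.
Hypothesis CD : forall phi psi, {morph C phi psi : x y / x + y}.
Hypothesis Cwd : forall phi psi s,
  C phi psi (wd s) = contract_seq gn wd e phi psi s.
Implicit Types (phi psi : R -> K) (x y : R) (s t : seq G).

Lemma contract_letter phi psi a : C phi psi (gn a) = (phi 1 * psi 1) *: e a.
Proof. by rewrite -[gn a]mulr1 -wd_nil -wd_cons Cwd /= addr0 wd_nil. Qed.

Lemma contract0 phi psi : C phi psi 0 = 0.
Proof. by rewrite -[LHS](addrK (C phi psi 0)) -CD !addr0 subrr. Qed.

Lemma contract1 phi psi : C phi psi 1 = 0.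
Proof. by rewrite -wd_nil Cwd. Qed.

Lemma contract_augM (el er : {rmorphism R -> K}) x y :
  C el er (x * y) = er y *: C el er x + el x *: C el er y.
Proof.
move: x y; apply: (eq_biadditive span) => [y x x'|x y y'|y x x'|x y y'|s t].
- by rewrite mulrDl CD.
- by rewrite mulrDr CD.
- by rewrite CD (rmorphD el) scalerDr scalerDl addrACA.
- by rewrite CD (rmorphD er) scalerDr scalerDl addrACA.
rewrite -(wd_cat wd_nil wd_cons) !Cwd (contract_seq_cat wd_nil wd_cons).
rewrite -(contract_seqZr _ _ _ (er _)) -contract_seqZl.
by congr (_ + _); apply: eq_contract_seq => // x; rewrite rmorphM.
Qed.

(** The extra term arises because h on a suffix that is cut in two splits by the
    derivation rule; the part of the word before the cut is then contracted
    with the augmentation er instead of h. *)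
Lemma contract_derrM (el er er' : {rmorphism R -> K}) (h : {additive R -> K})
    (hM : forall x y, h (x * y) = h x * er' y + er x * h y) x y :
  C el h (x * y) = er' y *: C el h x + h y *: C el er x + el x *: C el h y.
Proof.
move: x y; apply: (eq_biadditive span) => [y x x'|x y y'|y x x'|x y y'|s t].
- by rewrite mulrDl CD.
- by rewrite mulrDr CD.
- rewrite !CD (rmorphD el) !scalerDr scalerDl.
  by rewrite [X in X + _ = _]addrACA [LHS]addrACA.
- rewrite !CD (rmorphD er') (raddfD h) !scalerDr !scalerDl.
  by rewrite [X in X + _ = _]addrACA [LHS]addrACA.
rewrite -(wd_cat wd_nil wd_cons) !Cwd (contract_seq_cat wd_nil wd_cons).
rewrite -(contract_seqZr _ _ _ (er' _)) -(contract_seqZr _ _ _ (h _)).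
rewrite -contract_seqZl -contract_seqDr.
by congr (_ + _); apply: eq_contract_seq => // x; rewrite ?hM ?rmorphM.
Qed.

Lemma contract_derlM (el el' er : {rmorphism R -> K}) (h : {additive R -> K})
    (hM : forall x y, h (x * y) = h x * el' y + el x * h y) x y :
  C h er (x * y) = er y *: C h er x + (h x *: C el' er y + el x *: C h er y).
Proof.
move: x y; apply: (eq_biadditive span) => [y x x'|x y y'|y x x'|x y y'|s t].
- by rewrite mulrDl CD.
- by rewrite mulrDr CD.
- rewrite !CD (rmorphD el) (raddfD h) !scalerDr !scalerDl.
  by rewrite [X in _ + X = _]addrACA [LHS]addrACA.
- rewrite !CD (rmorphD er) !scalerDr scalerDl.
  by rewrite [X in _ + X = _]addrACA [LHS]addrACA.
rewrite -(wd_cat wd_nil wd_cons) !Cwd (contract_seq_cat wd_nil wd_cons).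
rewrite -(contract_seqZr _ _ _ (er _)) -!contract_seqZl -contract_seqDl.
by congr (_ + _); apply: eq_contract_seq => // x; rewrite ?hM ?rmorphM.
Qed.

Variable d : {additive R -> R}.
Hypothesis d1 : d 1 = 0.
Hypothesis dM : forall x y, d (x * y) = d x * y + x * d y.

Section Differential.
Variables (el er : {rmorphism R -> K}) (bd : {linear V -> V}).
Hypotheses (el_d : forall x, el (d x) = 0) (er_d : forall x, er (d x) = 0).
Hypothesis bdE : forall a, bd (e a) = C el er (d (gn a)).

(** In C(d w) the marked letter either lies in the differentiated letter, which
    gives bd, or elsewhere, and then el or er is applied to a boundary. *)
Lemma aug_contract_diff x : C el er (d x) = bd (C el er x).
Proof.
move: x; apply: (eq_additive span) => [x y|x y|s].
- by rewrite (raddfD d) CD.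
- by rewrite CD (raddfD bd).
elim: s => [|a s IH]; first by rewrite wd_nil d1 contract0 contract1 raddf0.
rewrite wd_cons dM CD !contract_augM IH el_d er_d contract_letter.
rewrite !rmorph1 mulr1 scale1r !scale0r addr0 add0r.
by rewrite linearD !linearZ bdE.
Qed.

End Differential.

Section RightHomotopy.
Variables (el er er' : {rmorphism R -> K}) (h : {additive R -> K}).
Variables (bd T : {linear V -> V}).
Hypothesis el_d : forall x, el (d x) = 0.
Hypothesis hM : forall x y, h (x * y) = h x * er' y + er x * h y.
Hypothesis hd : forall x, er x - er' x = h (d x).
Hypothesis bdE : forall a, bd (e a) = C el er (d (gn a)).
Hypothesis TE : forall a, T (e a) = C el h (d (gn a)).

(** In C(d w) the marked letter lies in the differentiated letter, or to its
    left, or to its right.  The first case gives T or bd, according to whether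
    the derivation rule of h picks that letter or a later one; the second
    gives h(d suffix) = er(suffix) - er'(suffix); in the third el is applied to
    a boundary. *)
Lemma right_homotopy_diff x : C el h (d x) =
  T (C el er' x) + bd (C el h x) + (C el er x - C el er' x).
Proof.
have h1 : h 1 = 0.
  by have := hM 1 1; rewrite !rmorph1 !mulr1 mul1r -{1}[h 1]addr0 => /addrI.
move: x; apply: (eq_additive span) => [x y|x y|s].
- by rewrite (raddfD d) CD.
- by rewrite !CD (raddfD T) (raddfD bd) opprD [X in _ + X = _]addrACA
    [X in X + _ = _]addrACA [LHS]addrACA.
elim: s => [|a s IH].
  by rewrite wd_nil d1 contract0 !contract1 !raddf0 !addr0.
rewrite wd_cons dM CD !(contract_derrM el hM) !contract_augM IH el_d.
rewrite !contract_letter h1 !rmorph1 mulr0 !mulr1 !scale0r !scaler0.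
rewrite !scale1r !addr0 !add0r -hd -TE -bdE.
rewrite !linearD !linearZ /=.
set u := T _; set v := bd (e a).
rewrite scalerBl !scalerN.
set p1 := er' _ *: u; set p2 := h _ *: v; set p3 := er _ *: e a.
set p4 := er' _ *: e a; set p5 := el _ *: T _; set p6 := el _ *: bd _.
set p7 := el _ *: C _ er _; set p8 := el _ *: C _ er' _.
(* Both sides now consist of the same eight terms. *)
by rewrite !addrA [LHS](ACl (1*5*2*6*3*7*4*8)).
Qed.

End RightHomotopy.

Section LeftHomotopy.
Variables (el el' er : {rmorphism R -> K}) (h : {additive R -> K}).
Variables (bd' T : {linear V -> V}).
Hypothesis el_d : forall x, el (d x) = 0.
Hypothesis el'_d : forall x, el' (d x) = 0.
Hypothesis er_d : forall x, er (d x) = 0.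
Hypothesis hM : forall x y, h (x * y) = h x * el' y + el x * h y.
Hypothesis hd : forall x, el x - el' x = h (d x).
Hypothesis bdE' : forall a, bd' (e a) = C el' er (d (gn a)).
Hypothesis TE : forall a, T (e a) = C h er (d (gn a)).

(** The mirror image of right_homotopy_diff.  Words are still peeled from the
    left, so the case where h meets the peeled letter needs the compatibility
    of (el', er) with the differentials. *)
Lemma left_homotopy_diff x : C h er (d x) =
  T (C el er x) + bd' (C h er x) + (C el er x - C el' er x).
Proof.
have h1 : h 1 = 0.
  by have := hM 1 1; rewrite !rmorph1 !mulr1 mul1r -{1}[h 1]addr0 => /addrI.
move: x; apply: (eq_additive span) => [x y|x y|s].
- by rewrite (raddfD d) CD.
- by rewrite !CD (raddfD T) (raddfD bd') opprD [X in _ + X = _]addrACA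
    [X in X + _ = _]addrACA [LHS]addrACA.
elim: s => [|a s IH].
  by rewrite wd_nil d1 contract0 !contract1 !raddf0 !addr0.
rewrite wd_cons dM CD !(contract_derlM er hM) !contract_augM IH el_d.
rewrite (aug_contract_diff el'_d er_d bdE') er_d.
rewrite !contract_letter h1 !rmorph1 mul0r !mulr1 !scale0r !scaler0.
rewrite !scale1r !addr0 !add0r -hd -TE.
rewrite !linearD !linearZ /=.
rewrite scalerBl !scalerN [X in _ = _ + X]addrACA subrr add0r.
set p := el _ *: C el' er _; set p' := el' _ *: C el' er _.
set q := el _ *: C el er _; set u := er _ *: _; set v := h _ *: _.
set t := el _ *: T _; set b := el _ *: bd' _.
(* The terms el *: C el' er of the two differences cancel. *)
by rewrite !addrA [LHS](ACl (2*8*(1*5*4*6*7*3))) /= subrr add0r.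
Qed.

End LeftHomotopy.

(** Both sides are derivations over (el, er) that agree on generators. *)
Lemma contract_natural (el er : {rmorphism R -> K}) (R' : pzRingType)
    (F : {rmorphism R -> R'}) (V' : lmodType K) (D : {additive R' -> V'})
    (el' er' : R' -> K) (Phi : {linear V -> V'}) :
  (forall x y : R', D (x * y) = er' y *: D x + el' x *: D y) ->
  (forall x, el x = el' (F x)) -> (forall x, er x = er' (F x)) ->
  (forall a, Phi (e a) = D (F (gn a))) ->
  forall x, D (F x) = Phi (C el er x).
Proof.
move=> DM elF erF PhiE.
have D1 : D 1 = 0.
  have := DM 1 1; rewrite -(rmorph1 F) -elF -erF !rmorph1 !scale1r mulr1.
  by rewrite -{1}[D 1]addr0 => /addrI.
apply: (eq_additive span) => [x y|x y|s].
- by rewrite (rmorphD F) (raddfD D).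
- by rewrite CD (raddfD Phi).
elim: s => [|a s IH]; first by rewrite wd_nil rmorph1 contract1 raddf0.
rewrite wd_cons rmorphM DM contract_augM contract_letter IH -elF -erF.
by rewrite !rmorph1 mulr1 scale1r linearD !linearZ PhiE.
Qed.

End Contraction.

Section RingMorphismDiff.
Variables (G : Type) (R : pzRingType) (gn : G -> R) (wd : seq G -> R).
Hypothesis wd_nil : wd [::] = 1.
Hypothesis wd_cons : forall a s, wd (a :: s) = gn a * wd s.
Hypothesis span : forall P : R -> Prop, P 0 ->
  (forall s x, P x -> P (wd s + x)) -> forall x, P x.
Variables (K : pzRingType) (d : {additive R -> R}) (eps : {rmorphism R -> K}).
Hypothesis d1 : d 1 = 0.
Hypothesis dM : forall x y, d (x * y) = d x * y + x * d y.

(** The elements on which eps o d vanishes are closed under products. *)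
Lemma rmorph_diff0 : (forall a, eps (d (gn a)) = 0) -> forall x, eps (d x) = 0.
Proof.
move=> eps0; elim/span => [|s x IH]; first by rewrite !raddf0.
rewrite (raddfD d) rmorphD IH addr0 {x IH}.
elim: s => [|a s IH]; first by rewrite wd_nil d1 raddf0.
by rewrite wd_cons dM rmorphD !rmorphM IH eps0 mul0r mulr0 addr0.
Qed.

End RingMorphismDiff.

(** * Contractions of the tensor algebra *)

Lemma F2_case (c : 'F_2) : c = 0 \/ c = 1.
Proof. by case: c => [[|[|//]] ?]; [left|right]; apply: val_inj. Qed.

Lemma word_span (G : finType) (P : 'T(G) -> Prop) : P 0 ->
  (forall s x, P x -> P (word s + x)) -> forall x, P x.
Proof.
move=> P0 PD; elim/tensor_ind => // c [s] x Px.
by case: (F2_case c) => ->; rewrite ?scale0r ?add0r // scale1r; apply: PD.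
Qed.

Section TensorContraction.
Variables (rho : nat) (A : mfDGA rho).
Implicit Types (phi psi : alg A -> 'F_2) (x y : alg A) (s t : seq (gen A)).

Definition contract phi psi : alg A -> vect A :=
  lin_ext (fun w : {fmonom gen A} =>
    contract_seq (@letter _) (fun s => word s) (@basis _ A) phi psi w).

HB.instance Definition _ phi psi := GRing.Linear.on (contract phi psi).

Lemma contractD phi psi : {morph contract phi psi : x y / x + y}.
Proof. by move=> x y; apply: linearD. Qed.

Lemma contract_word phi psi s : contract phi psi (word s) =
  contract_seq (@letter _) (fun s => word s) (@basis _ A) phi psi s.
Proof. exact: lin_ext_word. Qed.

Definition basis_ext (W : lmodType 'F_2) (g : gen A -> W) (v : vect A) : W :=
  \sum_a v a *: g a.

Lemma basis_ext_linear (W : lmodType 'F_2) (g : gen A -> W) :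
  linear (basis_ext g).
Proof.
move=> c u v; rewrite scaler_sumr -big_split; apply: eq_bigr => a _ /=.
by rewrite !ffunE scalerDl scalerA.
Qed.

HB.instance Definition _ (W : lmodType 'F_2) (g : gen A -> W) :=
  GRing.isLinear.Build 'F_2 (vect A) W _ (basis_ext g) (basis_ext_linear g).

Lemma basis_extE (W : lmodType 'F_2) (g : gen A -> W) a :
  basis_ext g (basis a) = g a.
Proof.
rewrite /basis_ext (bigD1 a) //= ffunE eqxx scale1r big1 ?addr0 // => b ba.
by rewrite ffunE (negPf ba) scale0r.
Qed.

Lemma vect_basis (v : vect A) : v = \sum_a v a *: basis a.
Proof.
apply/ffunP => b; rewrite sum_ffunE (bigD1 b) //= big1 ?addr0.
  by rewrite !ffunE eqxx /GRing.scale /= mulr1.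
by move=> a ab; rewrite !ffunE eq_sym (negPf ab) scaler0.
Qed.

Section Augs.
Variables el er : augmentation A.

Lemma contract_seq_bilin s :
  contract_seq (@letter _) (fun s => word s) (@basis _ A) el er s =
  bilin_word el er (FMonom s).
Proof.
exact: (contract_seq_sum (@word_nil _) (@word_cons _) (@basis _ A)).
Qed.

Lemma bdiff_basis a :
  bdiff el er (basis a) = contract el er (diff A (letter a)).
Proof.
rewrite [LHS](basis_extE
  (fun a => lin_ext (bilin_word el er) (diff A (letter a)))).
by apply: eq_bigr => -[s] _; rewrite -contract_seq_bilin.
Qed.

End Augs.
End TensorContraction.

(** * Isomorphisms of pages *)

Section QuotientIso.
Variables (gT rT : finGroupType) (f : gT -> rT).
Variables (Z B : {group gT}) (Z' B' : {group rT}).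
Local Open Scope group_scope.

(** The map from Z to Z' / B' has kernel Z :&: B, and Z / (Z :&: B) is Z / B by
    the second isomorphism theorem. *)
Lemma quotient_isog_map : abelian [set: gT] -> abelian [set: rT] ->
  {morph f : x y / x * y} ->
  {in Z, forall z, f z \in Z'} -> {in Z, forall z, (f z \in B') = (z \in B)} ->
  {in Z', forall z, exists2 y, y \in Z & z * (f y)^-1 \in B'} ->
  Z / B \isog Z' / B'.
Proof.
move=> abA abB fM fZ fB fsurj.
have nB (C : {group gT}) : Z \subset 'N(C).
  exact: subset_trans (subsetT _) (sub_abelian_norm abA (subsetT _)).
have nB' z : z \in 'N(B').
  exact: (subsetP (sub_abelian_norm abB (subsetT B'))).
pose q v := coset B' (f v).
have qM : {in Z &, {morph q : x y / x * y}}.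
  by move=> x y _ _; rewrite /q fM morphM ?nB'.
have kerE : 'ker (Morphism qM) = B :&: Z.
  apply/setP => z; rewrite inE [in RHS]inE andbC.
  case zZ: (z \in Z); last by rewrite !andbF.
  rewrite !andbT inE /= inE -(fB _ zZ).
  by apply/eqP/idP => [/coset_idr|/coset_id]; first by apply.
have imE : Morphism qM @* Z = Z' / B'.
  apply/setP => c; apply/morphimP/morphimP.
    by case=> z _ zZ ->; exists (f z); rewrite ?nB' ?fZ.
  case=> z _ zZ' ->; have [y yZ zy] := fsurj _ zZ'.
  by exists y => //=; rewrite -[z](mulgKV (f y)) coset_kerl.
have := first_isog (Morphism qM); rewrite imE kerE => iso1.
by apply: isog_trans iso1; rewrite isog_sym second_isog.
Qed.

End QuotientIso.

Definition respects rho (A B : mfDGA rho) (k : int) (f : vect A -> vect B) :=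
  (forall p v, filtV p v -> filtV p (f v)) /\
  (forall d v, degV d v -> degV (d + k) (f v)).

Section Pages.
Variable rho : nat.

Lemma vect_abelian (A : mfDGA rho) : abelian [set: vect A].
Proof.
apply/centsP => u _ v _.
by rewrite /commute !FinRing.zmodMgE addrC.
Qed.

Lemma filtV_le (A : mfDGA rho) p q (v : vect A) :
  p <= q -> filtV p v -> filtV q v.
Proof.
move=> pq /forallP hv; apply/forallP => a; apply/implyP => va.
exact: le_trans (implyP (hv a) va) pq.
Qed.

Section Maps.
Variables (A B : mfDGA rho) (el er : augmentation A) (el' er' : augmentation B).
Variable f : {linear vect A -> vect B}.
Hypothesis f_resp : respects 0 f.
Hypothesis f_chain : forall v, bdiff el' er' (f v) = f (bdiff el er v).

Lemma Zcyc_map r p d v : v \in Zcyc el er r p d -> f v \in Zcyc el' er' r p d.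
Proof.
case: f_resp => fp fd; rewrite !inE => /and3P[v1 v2 v3].
by rewrite f_chain !fp // -[d]addr0 fd.
Qed.

Lemma Bbnd_map r p d v : v \in Bbnd el er r p d -> f v \in Bbnd el' er' r p d.
Proof.
case/imset2P => u w uZ wZ ->; apply/imset2P.
exists (f u) (f w); rewrite ?Zcyc_map //.
by rewrite (linearD f) f_chain.
Qed.

End Maps.

(** The map induced by f is injective on pages because g retracts it.  It is
    surjective because, for z in Z^r_p, the difference
    z - f(g z) = K(bdiff z) + bdiff(K z) is of the form that B^r_p allows:
    K(bdiff z) has level p - r <= p - 1, and K z has level p <= p + r - 1.
    Both inequalities use r >= 1. *)
Lemma same_pages_retract (A B : mfDGA rho) (el er : augmentation A)
    (el' er' : augmentation B) (f : {linear vect A -> vect B})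
    (g : {linear vect B -> vect A}) (K : vect B -> vect B) :
  respects 0 f -> respects 0 g -> respects 1 K ->
  respects (-1) (bdiff el' er') ->
  (forall v, bdiff el' er' (f v) = f (bdiff el er v)) ->
  (forall v, bdiff el er (g v) = g (bdiff el' er' v)) ->
  cancel f g ->
  (forall v, v - f (g v) = K (bdiff el' er' v) + bdiff el' er' (K v)) ->
  same_pages el er el' er'.
Proof.
move=> fr gr [Kp Kd] [bp bd] fc gc fg fgK r p d r1.
apply: (@quotient_isog_map _ _ f (Zcyc_group el er r p d)
  (Bbnd_group el er r p d) (Zcyc_group el' er' r p d)
  (Bbnd_group el' er' r p d)).
- exact: vect_abelian.
- exact: vect_abelian.
- by move=> u v; rewrite !FinRing.zmodMgE (linearD f).
- by move=> z; apply: Zcyc_map.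
- move=> z _; apply/idP/idP; last exact: Bbnd_map.
  by move/(Bbnd_map gr gc); rewrite fg.
move=> z zZ; exists (g z); first exact: Zcyc_map zZ.
rewrite FinRing.zmodMgE FinRing.zmodVgE fgK; apply/imset2P.
move: zZ; rewrite inE => /and3P[z1 z2 z3].
exists (K (bdiff el' er' z)) (K z) => //.
  rewrite inE; apply/and3P; split.
  - apply: (@filtV_le _ (p - r%:Z)); first by lia.
    exact: Kp.
  - by rewrite -[d](subrK 1); apply/Kd/bd.
  have -> : p - 1 - (r%:Z - 1) = p - r%:Z by lia.
  exact/bp/Kp.
rewrite inE; apply/and3P; split.
- by apply: (@filtV_le _ p); [lia|apply: Kp].
- exact: Kd.
have -> : p + r%:Z - 1 - (r%:Z - 1) = p by lia.
exact/bp/Kp.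
Qed.

Lemma same_pages_iso (A B : mfDGA rho) (el er : augmentation A)
    (el' er' : augmentation B) (f : {linear vect A -> vect B})
    (g : {linear vect B -> vect A}) :
  respects 0 f -> respects 0 g ->
  respects (-1) (bdiff el' er') ->
  (forall v, bdiff el' er' (f v) = f (bdiff el er v)) ->
  cancel f g -> cancel g f ->
  same_pages el er el' er'.
Proof.
move=> fr gr br fc fg gf.
apply: (same_pages_retract (K := fun=> 0) fr gr _ br fc _ fg) => [|v|v].
- by split=> *; rewrite ?filtV0 ?degV0.
- by apply: (can_inj fg); rewrite -fc !gf.
by rewrite gf subrr bdiff0 addr0.
Qed.

Lemma same_pages_sym (A B : mfDGA rho) (el er : augmentation A)
    (el' er' : augmentation B) :
  same_pages el er el' er' -> same_pages el' er' el er.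
Proof. by move=> H r p d r1; rewrite isog_sym H. Qed.

Lemma same_pages_trans (A B C : mfDGA rho) (el er : augmentation A)
    (el' er' : augmentation B) (el'' er'' : augmentation C) :
  same_pages el er el' er' -> same_pages el' er' el'' er'' ->
  same_pages el er el'' er''.
Proof.
by move=> H H' r p d r1; apply: isog_trans (H _ _ _ r1) (H' _ _ _ r1).
Qed.

End Pages.

(** * Levels and degrees of contractions *)

Section Support.
Variables (rho : nat).
Local Notation n := (2 * rho)%N.

Lemma basis_ext_support (A B : mfDGA rho) (g : gen A -> vect B) v b :
  basis_ext g v b != 0 -> exists2 a, v a != 0 & g a b != 0.
Proof.
move=> nz; have [/existsP[a /andP[? ?]]|no] :=
  boolP [exists a, (v a != 0) && (g a b != 0)]; first by exists a.
case/eqP: nz; rewrite sum_ffunE big1 // => a _; rewrite ffunE.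
move/existsPn: no => /(_ a); rewrite negb_and !negbK => /orP[/eqP->|/eqP->].
  exact: scale0r.
exact: scaler0.
Qed.

Lemma basis_ext_respects (A B : mfDGA rho) k (g : gen A -> vect B) :
  (forall a b, g a b != 0 ->
     (glev b <= glev a)%N /\ (gdeg b = gdeg a + k %[mod n])%Z) ->
  respects k (basis_ext g).
Proof.
move=> hg; split=> [p|d] v /forallP hv; apply/forallP => b; apply/implyP.
  case/basis_ext_support => a va /hg[ba _]; apply: le_trans (implyP (hv a) va).
  by rewrite lez_nat.
case/basis_ext_support => a va /hg[_ ->].
by rewrite eqz_modDr (implyP (hv a) va).
Qed.

Variable A : mfDGA rho.
Implicit Types (phi psi : alg A -> 'F_2).

Lemma contract_support phi psi x b : contract phi psi x b != 0 ->
  exists p q, [/\ FMonom (p ++ b :: q) \in msupp x,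
                  phi (word p) != 0 & psi (word q) != 0].
Proof.
pose Q (v : vect A) := v b != 0 -> exists p q,
  [/\ FMonom (p ++ b :: q) \in msupp x, phi (word p) != 0 & psi (word q) != 0].
have Q0 : Q 0 by rewrite /Q ffunE eqxx.
have QD u v : Q u -> Q v -> Q (u + v).
  rewrite /Q ffunE => hu hv; have [->|/hu //] := eqVneq (u b) 0.
  by rewrite add0r.
have QZ (c : 'F_2) u : Q u -> Q (c *: u).
  rewrite /Q ffunE => hu; have [->|/hu //] := eqVneq (u b) 0.
  by rewrite scaler0 eqxx.
change (Q (contract phi psi x)).
apply: lin_ext_closed => // -[s] sx; apply: contract_seq_support => //.
  exact: word_nil.
  exact: word_cons.
move=> p a q E; rewrite /Q !ffunE.
have [->|_] := eqVneq b a; last by rewrite scaler0 eqxx.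
rewrite /GRing.scale /= mulr1 mulf_eq0 negb_or => /andP[hp hq].
by exists p, q; rewrite -[p ++ _]E.
Qed.

(** Functionals homogeneous of degree - i: i = 0 for augmentations, i = -1 for
    homotopies. *)
Definition vanishes_off (i : int) phi := forall d x,
  homogeneous rho (@gdeg _ A) d x -> (d <> i %[mod n])%Z -> phi x = 0.

Lemma word_degree phi i (s : seq (gen A)) : vanishes_off i phi ->
  phi (word s) != 0 -> (\sum_(a <- s) gdeg a = i %[mod n])%Z.
Proof.
move=> phi0 nz; apply/eqP; apply: contraNT nz => /eqP H; apply/eqP.
exact: phi0 (@homogeneous_word _ rho (@gdeg _ A) (FMonom s)) H.
Qed.

Lemma contract_graded phi psi i j d l x b :
  vanishes_off i phi -> vanishes_off j psi ->
  homogeneous rho (@gdeg _ A) d x -> in_filt (@glev _ A) l x ->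
  contract phi psi x b != 0 ->
  (glev b <= l)%N /\ (gdeg b = d - i - j %[mod n])%Z.
Proof.
move=> phi0 psi0 xd xl /contract_support[p [q [w]]].
move=> /(word_degree phi0) pi /(word_degree psi0) qj; split.
  by have := xl _ w; rewrite /= all_cat /= => /and3P[].
have := xd _ w; rewrite /= big_cat big_cons /=; move: pi qj.
move: (\sum_(a <- p) gdeg a) (\sum_(a <- q) gdeg a) => P Q.
move=> /eqP + /eqP + /eqP; rewrite !eqz_mod_dvd.
move=> /dvdzP[u eu] /dvdzP[v ev] /dvdzP[t et].
apply/eqP; rewrite eqz_mod_dvd; apply/dvdzP; exists (t - u - v).
by rewrite !mulrBl -eu -ev -et; lia.
Qed.

End Support.

Section Grading.
Variable rho : nat.
Local Notation n := (2 * rho)%N.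

Lemma contract_respects (A B : mfDGA rho) phi psi i j k (F : gen A -> alg B) :
  vanishes_off i phi -> vanishes_off j psi ->
  (forall a, homogeneous rho (@gdeg _ B) (gdeg a + k) (F a)) ->
  (forall a, in_filt (@glev _ B) (glev a) (F a)) ->
  respects (k - i - j) (basis_ext (fun a => contract phi psi (F a))).
Proof.
move=> phi0 psi0 Fd Fl; apply: basis_ext_respects => a b.
by rewrite !addrA; apply: contract_graded.
Qed.

Lemma aug_vanishes (A : mfDGA rho) (el : augmentation A) : vanishes_off 0 el.
Proof. exact: aug_deg. Qed.

Lemma letter_homogeneous (A : mfDGA rho) a :
  homogeneous rho (@gdeg _ A) (gdeg a) (letter a).
Proof.
by have := @homogeneous_word _ rho (@gdeg _ A) (fmu a); rewrite fmU big_seq1.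
Qed.

Lemma letter_filt (A : mfDGA rho) a : in_filt (@glev _ A) (glev a) (letter a).
Proof. by apply: in_filt_word; rewrite fmU /= leqnn. Qed.

Lemma basis_span (A : mfDGA rho) (W : lmodType 'F_2)
    (f g : {linear vect A -> W}) :
  (forall a, f (basis a) = g (basis a)) -> f =1 g.
Proof.
move=> fg v; rewrite (vect_basis v) !linear_sum; apply: eq_bigr => a _.
by rewrite !linearZ fg.
Qed.

Lemma bdiffE (A : mfDGA rho) (el er : augmentation A) :
  bdiff el er =1 basis_ext (fun a => contract el er (diff A (letter a))).
Proof.
apply: (@basis_span _ _ (bdiff el er)
  (basis_ext (fun a => contract el er (diff A (letter a))))) => a.
by rewrite /= bdiff_basis basis_extE.
Qed.

Lemma eq_respects (A B : mfDGA rho) k (f g : vect A -> vect B) : f =1 g ->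
  respects k g -> respects k f.
Proof. by move=> fg [gp gd]; split=> [p|d] v hv; rewrite fg; auto. Qed.

Lemma diff_respects (A : mfDGA rho) phi psi i j :
  vanishes_off (A := A) i phi -> vanishes_off j psi ->
  respects (-1 - i - j)
    (basis_ext (fun a => contract phi psi (diff A (letter a)))).
Proof.
move=> phi0 psi0; apply: contract_respects => // a.
  exact/diff_deg/letter_homogeneous.
exact/diff_filt/letter_filt.
Qed.

Lemma bdiff_respects (A : mfDGA rho) (el er : augmentation A) :
  respects (-1) (bdiff el er).
Proof.
apply: eq_respects (bdiffE el er) _.
have := diff_respects (aug_vanishes el) (aug_vanishes er).
by rewrite !subr0.
Qed.

(** * Homotopic augmentations *)

Section Unipotent.
Variables (A : mfDGA rho) (t : gen A -> vect A) (ht : gen A -> nat).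
Hypothesis t_resp : respects 0 (basis_ext t).
Hypothesis t_lower : forall a b, t a b != 0 -> (ht b < ht a)%N.

Definition unip (v : vect A) : vect A := v + basis_ext t v.

Lemma unip_linear : linear unip.
Proof. by move=> c u v; rewrite /unip linearP /= scalerDr addrACA. Qed.

HB.instance Definition _ :=
  GRing.isLinear.Build 'F_2 (vect A) (vect A) _ unip unip_linear.

(** If v + T v = 0, a letter of maximal height in v must occur in T v, but T v
    only involves letters lower than some letter of v. *)
Lemma unip_inj : injective unip.
Proof.
suff H v : unip v = 0 -> v = 0.
  move=> u v E; apply/eqP; rewrite -subr_eq0; apply/eqP/H.
  by rewrite linearB /= E subrr.
move=> v0; apply/eqP; apply: contraT => /eqP nz.
have [b vb] : exists b, v b != 0.
  apply/existsP; apply: contraT => /existsPn v0'; case: nz; apply/ffunP => b.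
  by rewrite ffunE; move: (v0' b); rewrite negbK => /eqP.
case: (@arg_maxnP _ b (fun b => v b != 0) ht vb) => {vb}b vb max.
have : basis_ext t v b != 0.
  apply: contra vb => /eqP e0; have := congr1 (fun u : vect A => u b) v0.
  by rewrite /unip !ffunE e0 addr0 => ->.
case/basis_ext_support => a /max le /t_lower lt.
by have := leq_trans lt le; rewrite ltnn.
Qed.

Lemma unip_respects : respects 0 unip.
Proof.
by case: t_resp => tp td; split=> [p|d] v hv; [apply: filtVD|apply: degVD];
  rewrite ?addr0 //; [apply: tp|rewrite -[d]addr0; apply: td].
Qed.

Lemma unip_inv_linear : linear (finv unip).
Proof.
by move=> c u v; apply: unip_inj; rewrite linearP /= !(f_finv unip_inj).
Qed.

(** On each vector the inverse of a permutation of a finite set is an iterate of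
    the permutation. *)
Lemma finv_respects : respects 0 (finv unip).
Proof.
have [fp fd] := unip_respects.
split=> [p|d] v hv; rewrite /finv ?addr0.
  by elim: (_.-1) => //= m; apply: fp.
by elim: (_.-1) => //= m; rewrite -{2}[d]addr0; apply: fd.
Qed.

End Unipotent.

Lemma unipotent_same_pages (A : mfDGA rho) (el er el' er' : augmentation A)
    (t : gen A -> vect A) (ht : gen A -> nat) :
  respects 0 (basis_ext t) -> (forall a b, t a b != 0 -> (ht b < ht a)%N) ->
  (forall a,
     bdiff el' er' (unip t (basis a)) = unip t (bdiff el er (basis a))) ->
  same_pages el er el' er'.
Proof.
move=> tr tl fc.
pose gL := GRing.isLinear.Build 'F_2 (vect A) (vect A) _
  (finv (unip t)) (unip_inv_linear tl).
pose g : {linear vect A -> vect A} := HB.pack (finv (unip t)) gL.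
have inj := unip_inj tl.
apply: (@same_pages_iso _ _ _ _ _ _ _ (unip t) g).
- exact: unip_respects.
- exact: finv_respects.
- exact: bdiff_respects.
- exact: (basis_span (f := bdiff el' er' \o unip t)
    (g := unip t \o bdiff el er)).
- exact: finv_f.
- exact: f_finv.
Qed.

End Grading.

Section Invariance.
Variable rho : nat.
Local Notation n := (2 * rho)%N.

Lemma contract_diff (A : mfDGA rho) (el er : augmentation A) x :
  contract el er (diff A x) = bdiff el er (contract el er x).
Proof.
apply: (aug_contract_diff (@word_nil _) (@word_cons _) (@word_span _)
  (@contractD _ A) (@contract_word _ A) (diff1 A) (@diffM _ A)
  (@aug_diff _ A el) (@aug_diff _ A er)) => a.
exact: bdiff_basis.
Qed.

Lemma contract_gen (A : mfDGA rho) (el er : augmentation A) a :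
  contract el er (letter a) = basis a.
Proof.
rewrite (contract_letter (@word_nil _) (@word_cons _) (@contract_word _ A)).
by rewrite !rmorph1 mulr1 scale1r.
Qed.

Lemma contract_mul (A : mfDGA rho) (el er : augmentation A) x y :
  contract el er (x * y) = er y *: contract el er x + el x *: contract el er y.
Proof.
exact: (contract_augM (@word_nil _) (@word_cons _) (@word_span _)
  (@contractD _ A) (@contract_word _ A)).
Qed.

Lemma homotopy_vanishes (A : mfDGA rho) (h : alg A -> 'F_2) :
  (forall d x, homogeneous rho (@gdeg _ A) d x ->
     (d + 1 <> 0 %[mod n])%Z -> h x = 0) -> vanishes_off (-1) h.
Proof.
move=> h0 d x xd dn; apply: h0 xd _ => /eqP E; apply: dn; apply/eqP.
by rewrite -(eqz_modDr 1) addNr.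
Qed.

Lemma contract_diff_lowers (A : mfDGA rho) phi psi (ht : gen A -> nat) :
  (forall a b, occurs b (diff A (letter a)) -> (ht b < ht a)%N) ->
  forall a b, contract phi psi (diff A (letter a)) b != 0 -> (ht b < ht a)%N.
Proof.
move=> tri a b /contract_support[p [q [w _ _]]]; apply: tri.
by exists (FMonom (p ++ b :: q)); rewrite //= mem_cat inE eqxx orbT.
Qed.

Lemma contract_right_homotopy (A : mfDGA rho) (el er er' : augmentation A)
    (h : {linear alg A -> 'F_2 | *%R}) (t : gen A -> vect A) :
  (forall x y, h (x * y) = h x * er' y + er x * h y) ->
  (forall x, er x - er' x = h (diff A x)) ->
  (forall a, t a = contract el h (diff A (letter a))) ->
  forall x, contract el h (diff A x) =
    basis_ext t (contract el er' x) + bdiff el er (contract el h x)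
    + (contract el er x - contract el er' x).
Proof.
move=> hM hd tE.
apply: (right_homotopy_diff (@word_nil _) (@word_cons _) (@word_span _)
  (@contractD _ A) (@contract_word _ A) (diff1 A) (@diffM _ A)
  (@aug_diff _ A el) hM hd (bdiff_basis el er)) => a.
by rewrite -tE; apply: basis_extE.
Qed.

Lemma contract_left_homotopy (A : mfDGA rho) (el el' er : augmentation A)
    (h : {linear alg A -> 'F_2 | *%R}) (t : gen A -> vect A) :
  (forall x y, h (x * y) = h x * el' y + el x * h y) ->
  (forall x, el x - el' x = h (diff A x)) ->
  (forall a, t a = contract h er (diff A (letter a))) ->
  forall x, contract h er (diff A x) =
    basis_ext t (contract el er x) + bdiff el' er (contract h er x)
    + (contract el er x - contract el' er x).
Proof.
move=> hM hd tE.
apply: (left_homotopy_diff (@word_nil _) (@word_cons _) (@word_span _)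
  (@contractD _ A) (@contract_word _ A) (diff1 A) (@diffM _ A)
  (@aug_diff _ A el) (@aug_diff _ A el') (@aug_diff _ A er) hM hd
  (bdiff_basis el' er)) => a.
by rewrite -tE; apply: basis_extE.
Qed.

Lemma oppr_F2 (U : lmodType 'F_2) (u : U) : - u = u.
Proof. by apply/eqP; rewrite -subr_eq0 -opprD addxx oppr0. Qed.

(** At diff a the identity of contract_right_homotopy reads
    0 = T(bdiff' a) + bdiff(T a) + bdiff a - bdiff' a; in characteristic 2 this
    says that 1 + T is a chain map from bdiff' to bdiff. *)
Lemma same_pages_homotopic_right (A : mfDGA rho) (el er er' : augmentation A) :
  triangular A -> homotopic er er' -> same_pages el er' el er.
Proof.
move=> [ht tri] [h [h0 hM hd]].
pose t a := contract el h (diff A (letter a)).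
apply: (@unipotent_same_pages _ _ _ _ _ _ t ht) => [||a].
- have := diff_respects (aug_vanishes el) (homotopy_vanishes h0).
  by rewrite subr0 opprK addNr.
- exact: contract_diff_lowers tri.
have := @contract_right_homotopy A el er er' h t hM hd (fun=> erefl)
  (diff A (letter a)).
rewrite diffK (linear0 (contract el h)) -!bdiff_basis => /esym E.
rewrite /unip bdiffD basis_extE -/(t a).
apply/eqP; rewrite -subr_eq0; apply/eqP; rewrite -[RHS]E !oppr_F2.
exact: (AC (2*2) ((4*2)*(1*3))).
Qed.

Lemma same_pages_homotopic_left (A : mfDGA rho) (el el' er : augmentation A) :
  triangular A -> homotopic el el' -> same_pages el er el' er.
Proof.
move=> [ht tri] [h [h0 hM hd]].
pose t a := contract h er (diff A (letter a)).
apply: (@unipotent_same_pages _ _ _ _ _ _ t ht) => [||a].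
- have := diff_respects (homotopy_vanishes h0) (aug_vanishes er).
  by rewrite subr0 opprK addNr.
- exact: contract_diff_lowers tri.
have := @contract_left_homotopy A el el' er h t hM hd (fun=> erefl)
  (diff A (letter a)).
rewrite diffK (linear0 (contract h er)) -!bdiff_basis => /esym E.
rewrite /unip bdiffD basis_extE -/(t a).
apply/eqP; rewrite -subr_eq0; apply/eqP; rewrite -[RHS]E !oppr_F2.
exact: (AC (2*2) ((4*2)*(3*1))).
Qed.

(** * Morphisms *)

Section Pullback.
Variables (A B : mfDGA rho) (F : {lrmorphism alg A -> alg B}).
Hypothesis F_mor : mf_morphism F.

Section Aug.
Variable el : augmentation B.

Definition pullback_map : {lrmorphism alg A -> 'F_2 | *%R} := el \o F.

Lemma pullback_deg d x : homogeneous rho (@gdeg _ A) d x ->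
  (d <> 0 %[mod n])%Z -> pullback_map x = 0.
Proof. by case: F_mor => Fd _ _ /Fd; apply: aug_deg. Qed.

Lemma pullback_diff x : pullback_map (diff A x) = 0.
Proof. by case: F_mor => _ _ Fdiff; rewrite /= Fdiff aug_diff. Qed.

Definition pullback : augmentation A := Augmentation pullback_deg pullback_diff.

End Aug.

Variables (el' er' : augmentation B) (el er : augmentation A).
Hypotheses (elE : forall x, el x = el' (F x))
           (erE : forall x, er x = er' (F x)).

(** The linearization of F at el', er': when these vanish on generators, it is
    the component of F from generators to words of length one. *)
Definition induced : vect A -> vect B :=
  basis_ext (fun a => contract el' er' (F (letter a))).

HB.instance Definition _ := GRing.Linear.on induced.

Lemma contract_induced x : contract el' er' (F x) = induced (contract el er x).
Proof.
apply: (contract_natural (@word_nil _) (@word_cons _) (@word_span _)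
  (@contractD _ A) (@contract_word _ A) (contract_mul el' er') elE erE) => a.
exact: basis_extE.
Qed.

Lemma induced_respects : respects 0 induced.
Proof.
case: F_mor => Fd Fl _.
have := @contract_respects _ A B _ _ 0 0 0 (fun a => F (letter a))
  (aug_vanishes el') (aug_vanishes er').
rewrite !subr0; apply=> a; first by rewrite addr0; apply/Fd/letter_homogeneous.
exact/Fl/letter_filt.
Qed.

Lemma induced_chain v : bdiff el' er' (induced v) = induced (bdiff el er v).
Proof.
case: F_mor => _ _ Fdiff.
apply: (basis_span (f := bdiff el' er' \o induced)
  (g := induced \o bdiff el er)) => a /=.
rewrite bdiff_basis /induced basis_extE -contract_diff -Fdiff.
exact: contract_induced.
Qed.

End Pullback.

(** The maps induced by F and by its inverse are inverse to each other by
    contract_induced, since contract el er is the identity on generators. *)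
Lemma same_pages_pullback (A B : mfDGA rho) (F : {lrmorphism alg A -> alg B})
    (el er : augmentation A) (el' er' : augmentation B) :
  mf_isomorphism F ->
  (forall x, el x = el' (F x)) -> (forall x, er x = er' (F x)) ->
  same_pages el er el' er'.
Proof.
move=> [Fm [F' [Fm' FK FK']]] elE erE.
have elE' x : el' x = el (F' x) by rewrite elE FK'.
have erE' x : er' x = er (F' x) by rewrite erE FK'.
apply: (@same_pages_iso _ _ _ _ _ _ _ (induced F el' er') (induced F' el er)).
- exact: induced_respects.
- exact: induced_respects.
- exact: bdiff_respects.
- exact: induced_chain.
- apply: (basis_span (f := induced F' el er \o induced F el' er') (g := idfun)).
  move=> a /=; rewrite {2}/induced basis_extE -(contract_induced elE' erE') FK.
  exact: contract_gen.
- apply: (basis_span (f := induced F el' er' \o induced F' el er) (g := idfun)).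
  move=> a /=; rewrite {2}/induced basis_extE -(contract_induced elE erE) FK'.
  exact: contract_gen.
Qed.

Lemma collections_iso (A B : mfDGA rho) (F : {lrmorphism alg A -> alg B}) :
  mf_isomorphism F -> same_page_collections A B.
Proof.
move=> Fiso; have [Fm [F' [Fm' FK FK']]] := Fiso; split=> el er.
  exists (pullback Fm' el), (pullback Fm' er).
  by apply: (same_pages_pullback Fiso) => x /=; rewrite FK.
exists (pullback Fm el), (pullback Fm er).
exact: (same_pages_pullback Fiso).
Qed.

Lemma collections_refl (A : mfDGA rho) : same_page_collections A A.
Proof.
by split=> el er; exists el, er => r p d _; apply: isog_refl.
Qed.

Lemma collections_sym (A B : mfDGA rho) :
  same_page_collections A B -> same_page_collections B A.
Proof.
move=> [AB BA]; split=> el er.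
  by have [el' [er' /same_pages_sym H]] := BA el er; exists el', er'.
by have [el' [er' /same_pages_sym H]] := AB el er; exists el', er'.
Qed.

Lemma collections_trans (A B C : mfDGA rho) :
  same_page_collections A B -> same_page_collections B C ->
  same_page_collections A C.
Proof.
move=> [AB BA] [BC CB]; split=> el er.
  have [el' [er' H]] := AB el er; have [el'' [er'' H']] := BC el' er'.
  by exists el'', er''; apply: same_pages_trans H H'.
have [el' [er' H]] := CB el er; have [el'' [er'' H']] := BA el' er'.
by exists el'', er''; apply: same_pages_trans H' H.
Qed.

Lemma collections_tame (A B : mfDGA rho) :
  tame_iso A B -> same_page_collections A B.
Proof.
elim=> [{}A {}B [F [? [? [? [? [Fiso _ _ _ _]]]]]]|{}A|{}A {}B C _ AB _].
- exact: collections_iso Fiso.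
- exact: collections_refl.
exact: collections_trans.
Qed.

End Invariance.

(** * Stabilizations *)

(** The complex of (el', er') is that of (el, er) plus an acyclic summand
    spanned by x and y = bdiff x, both of one level; sending y back to x is a
    contracting homotopy of this summand that respects the filtration. *)

Section Acyclic.
Variables (rho : nat) (A B : mfDGA rho).
Variables (i : gen A -> gen B) (j : gen B -> option (gen A)) (x y : gen B).
Variables (el er : augmentation A) (el' er' : augmentation B).
Hypothesis genB : forall P : gen B -> Prop,
  (forall a, P (i a)) -> P x -> P y -> forall b, P b.
Hypothesis ij : forall a, j (i a) = Some a.
Hypotheses (jx : j x = None) (jy : j y = None).
Hypothesis xy : x != y.
Hypothesis i_lev : forall a, glev (i a) = glev a.
Hypothesis i_deg : forall a, gdeg (i a) = gdeg a.
Hypothesis y_lev : glev y = glev x.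
Hypothesis y_deg : gdeg y = gdeg x - 1.

Let incl := basis_ext (fun a => basis (i a)).
Let proj := basis_ext (fun b => if j b is Some a then basis a else 0).
Let htpy := basis_ext (fun b => if b == y then basis x else 0).
HB.instance Definition _ := GRing.Linear.on incl.
HB.instance Definition _ := GRing.Linear.on proj.
HB.instance Definition _ := GRing.Linear.on htpy.

Hypothesis bdiff_i : forall a,
  bdiff el' er' (basis (i a)) = incl (bdiff el er (basis a)).
Hypothesis bdiff_x : bdiff el' er' (basis x) = basis y.
Hypothesis bdiff_y : bdiff el' er' (basis y) = 0.

Let incl_basis a : incl (basis a) = basis (i a).
Proof. exact: basis_extE. Qed.
Let proj_i a : proj (basis (i a)) = basis a.
Proof. by rewrite /proj basis_extE ij. Qed.
Let proj_x : proj (basis x) = 0. Proof. by rewrite /proj basis_extE jx. Qed.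
Let proj_y : proj (basis y) = 0. Proof. by rewrite /proj basis_extE jy. Qed.
Let htpy_i a : htpy (basis (i a)) = 0.
Proof.
rewrite /htpy basis_extE; case: eqP => // iy.
by have := ij a; rewrite iy jy.
Qed.
Let htpy_x : htpy (basis x) = 0.
Proof. by rewrite /htpy basis_extE (negPf xy). Qed.
Let htpy_y : htpy (basis y) = basis x.
Proof. by rewrite /htpy basis_extE eqxx. Qed.

Let projK : cancel incl proj.
Proof.
by apply: (basis_span (f := proj \o incl) (g := idfun)) => a;
  rewrite /= incl_basis proj_i.
Qed.

Let htpy_incl v : htpy (incl v) = 0.
Proof.
by apply: (basis_span (f := htpy \o incl) (g := \0)) => a;
  rewrite /= incl_basis htpy_i.
Qed.

Let basis_support (C : mfDGA rho) (a c : gen C) : basis a c != 0 -> c = a.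
Proof. by rewrite ffunE; have [->|_] := eqVneq c a; rewrite ?eqxx. Qed.

Lemma same_pages_acyclic : same_pages el er el' er'.
Proof.
apply: (@same_pages_retract _ _ _ _ _ _ _ incl proj htpy).
- apply: basis_ext_respects => a b /basis_support->.
  by rewrite i_lev i_deg addr0.
- apply: basis_ext_respects => b a; move: b.
  apply: genB => [c||] /=; rewrite ?ij ?jx ?jy; last 2 first.
  + by rewrite ffunE eqxx.
  + by rewrite ffunE eqxx.
  by move/basis_support->; rewrite i_lev i_deg addr0.
- apply: basis_ext_respects => b a; have [->|_] := eqVneq b y; last first.
    by rewrite ffunE eqxx.
  by move/basis_support->; rewrite y_lev y_deg subrK.
- exact: bdiff_respects.
- apply: (basis_span (f := bdiff el' er' \o incl) (g := incl \o bdiff el er)).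
  by move=> a /=; rewrite incl_basis bdiff_i.
- apply: (basis_span (f := bdiff el er \o proj) (g := proj \o bdiff el' er')).
  apply: genB => [a||] /=.
  + by rewrite proj_i bdiff_i projK.
  + by rewrite proj_x bdiff_x proj_y bdiff0.
  + by rewrite proj_y bdiff_y bdiff0 linear0.
- exact: projK.
apply: (basis_span (f := idfun \- (incl \o proj))
  (g := (htpy \o bdiff el' er') \+ (bdiff el' er' \o htpy))).
apply: genB => [a||] /=.
- by rewrite proj_i incl_basis subrr bdiff_i htpy_incl htpy_i bdiff0 addr0.
- by rewrite proj_x linear0 subr0 bdiff_x htpy_y htpy_x bdiff0 addr0.
by rewrite proj_y linear0 subr0 bdiff_y linear0 htpy_y bdiff_x add0r.
Qed.

End Acyclic.

Section Stabilize.
Variable rho : nat.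
Local Notation n := (2 * rho)%N.

Section Stab.
Variables (A : mfDGA rho) (f : nat) (d : int).
Local Notation S := (stab A f d).
Local Notation incl := (@stab_incl rho A).

Lemma stab_incl_monoid : monoid_morphism incl.
Proof.
split; last exact: stab_inclM.
by rewrite -[in LHS]word_nil stab_incl_word word_nil.
Qed.

HB.instance Definition _ :=
  GRing.isMonoidMorphism.Build (alg A) 'T((gen A + bool)%type) incl
    stab_incl_monoid.

Definition stab_incl_mor : {lrmorphism alg A -> alg S} := incl.

Lemma stab_incl_letter a : incl (letter a) = letter (inl a).
Proof. by rewrite /letter fmuE stab_incl_word fmuE. Qed.

Lemma stab_incl_mf : mf_morphism stab_incl_mor.
Proof.
split=> [e x xe|l x xl|x].
- apply: lin_ext_closed => [||c u|w /xe we].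
  + exact: homogeneous0.
  + exact: homogeneousD.
  + exact: homogeneousZ.
  apply: homogeneous_mod (@homogeneous_word _ rho (@gdeg _ S) _).
  by rewrite /= big_map.
- apply: lin_ext_closed => [||c u|w /xl wl].
  + exact: in_filt0.
  + exact: in_filtD.
  + exact: in_filtZ.
  by apply: in_filt_word; rewrite /= all_map.
by rewrite /= /stab_diff der_stab_incl.
Qed.

Lemma induced_incl (el' er' : augmentation S) :
  induced stab_incl_mor el' er' =1 basis_ext (fun a => basis (inl a : gen S)).
Proof.
apply: (basis_span (f := induced stab_incl_mor el' er')
  (g := basis_ext (fun a => basis (inl a : gen S)))) => a /=.
rewrite /induced !basis_extE /= stab_incl_letter.
exact: (@contract_gen _ S).
Qed.

(** The augmentations el' and er' may be nonzero on a new generator of degree 0;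
    this leaves bdiff unchanged on the new basis vectors, because their
    differentials have no word of length two or more. *)
Lemma same_pages_stab (el er : augmentation A) (el' er' : augmentation S) :
  (forall x, el x = el' (incl x)) -> (forall x, er x = er' (incl x)) ->
  same_pages el er el' er'.
Proof.
move=> elE erE.
apply: (@same_pages_acyclic _ A S inl
  (fun b => if b is inl a then Some a else None) (inr true) (inr false)) => //.
- by move=> P Pi Px Py [a|[]].
- move=> a; rewrite -(basis_extE (fun a => basis (inl a : gen S)) a).
  rewrite -!(induced_incl el' er').
  exact: (induced_chain stab_incl_mf elE erE).
- rewrite bdiff_basis /= /stab_diff der_letter.
  exact: (@contract_gen _ S).
rewrite bdiff_basis /= /stab_diff der_letter.
exact: linear0.
Qed.

(** Every augmentation of A extends to the stabilization by zero on the new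
    generators. *)

Section Extension.
Variable el : augmentation A.

Definition stab_aug_gen (b : gen S) : 'F_2 :=
  if b is inl a then el (letter a) else 0.

Definition stab_aug : alg S -> 'F_2 :=
  lin_ext (fun w : {fmonom gen S} =>
    (\prod_(b <- w) stab_aug_gen b : ('F_2)^o)).

Lemma stab_aug_word (s : seq (gen S)) :
  stab_aug (word s) = \prod_(b <- s) stab_aug_gen b.
Proof. exact: (@lin_ext_word _ ('F_2)^o _ (FMonom s)). Qed.

Lemma stab_aug_linear : linear_for *%R stab_aug.
Proof. by move=> c x y; apply: (@lin_ext_is_linear _ ('F_2)^o _ c x y). Qed.

HB.instance Definition _ :=
  GRing.isLinear.Build 'F_2 (alg S) 'F_2 *%R stab_aug stab_aug_linear.

Lemma stab_augD : {morph stab_aug : x y / x + y}.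
Proof. exact: (raddfD stab_aug). Qed.

Lemma stab_aug_monoid : monoid_morphism stab_aug.
Proof.
split; first by rewrite -word_nil stab_aug_word big_nil.
apply: (eq_biadditive (@word_span _)) => [y x x'|x y y'|y x x'|x y y'|s t].
- by rewrite mulrDl stab_augD.
- by rewrite mulrDr stab_augD.
- by rewrite stab_augD mulrDl.
- by rewrite stab_augD mulrDr.
by rewrite -word_cat !stab_aug_word big_cat.
Qed.

HB.instance Definition _ :=
  GRing.isMonoidMorphism.Build (alg S) 'F_2 stab_aug stab_aug_monoid.

Lemma stab_aug_letter b : stab_aug (letter b) = stab_aug_gen b.
Proof. by rewrite /letter fmuE stab_aug_word big_seq1. Qed.

Lemma stab_aug_incl x : el x = stab_aug (incl x).
Proof.
apply: (eq_additive (@word_span _) (f := el) (g := stab_aug \o incl)).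
- exact: (raddfD el).
- exact: (raddfD (stab_aug \o stab_incl_mor)).
elim=> [|a s IH]; first by rewrite word_nil /= !rmorph1.
rewrite word_cons (rmorphM el) /= stab_inclM (rmorphM stab_aug).
rewrite stab_incl_letter.
congr (_ * _); last exact: IH.
exact/esym/(stab_aug_letter (inl a)).
Qed.

Lemma stab_aug_gen_deg b : stab_aug_gen b != 0 -> (@gdeg _ S b = 0 %[mod n])%Z.
Proof.
case: b => [a|b] /=; last by move/eqP.
move=> nz; apply/eqP; apply: contraNT nz => /eqP H; apply/eqP.
exact: (@aug_deg _ _ el _ _ (@letter_homogeneous _ A a) H).
Qed.

Lemma stab_aug_deg e x : homogeneous rho (@gdeg _ S) e x ->
  (e <> 0 %[mod n])%Z -> stab_aug x = 0.
Proof.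
move=> xe e0; rewrite /stab_aug.
apply: (@lin_ext_closed _ ('F_2)^o (fun u => u = 0)
  (fun w : {fmonom gen S} => \prod_(b <- w) stab_aug_gen b))
  => [//|u v -> ->|c u ->|w /xe we].
- exact: addr0.
- exact: scaler0.
apply/eqP; apply/negPn/negP => nz; apply: e0; rewrite -we {xe we}.
case: w nz => s /=; elim: s => [|b s IH]; first by rewrite !big_nil.
rewrite !big_cons mulf_eq0 negb_or => /andP[/stab_aug_gen_deg bd /IH sd].
by rewrite -modzDm bd sd modzDm.
Qed.

Lemma stab_aug_diff x : stab_aug (diff S x) = 0.
Proof.
apply: (rmorph_diff0 (@word_nil _) (@word_cons _) (@word_span _) (diff1 S)
  (@diffM _ S)).
case=> [a|[]]; rewrite /= [stab_diff _]der_letter /=; last exact: linear0.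
  by rewrite -stab_aug_incl aug_diff.
exact: (stab_aug_letter (inr false)).
Qed.

Definition stab_augmentation : augmentation S :=
  Augmentation (aug := stab_aug) stab_aug_deg stab_aug_diff.

End Extension.

Lemma collections_stab : same_page_collections A S.
Proof.
split=> el er.
  exists (stab_augmentation el), (stab_augmentation er).
  by apply: same_pages_stab => x; apply: stab_aug_incl.
exists (pullback stab_incl_mf el), (pullback stab_incl_mf er).
exact: same_pages_stab.
Qed.

End Stab.

Lemma collections_stabs (A : mfDGA rho) s :
  same_page_collections A (stabs A s).
Proof.
elim: s A => [|[f d] s IH] A; first exact: collections_refl.
exact: collections_trans (collections_stab A f d) (IH _).
Qed.

End Stabilize.

Theorem lemma5p26 (rho : nat) (A : mfDGA rho) :
  (triangular A ->
   forall el el' er er' : augmentation A,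
     homotopic el el' -> homotopic er er' -> same_pages el er el' er') /\
  (forall B : mfDGA rho, stable_tame_iso A B -> same_page_collections A B).
Proof.
split=> [tri el el' er er' hl hr|B [s [t AB]]].
  apply: same_pages_trans (same_pages_homotopic_left er tri hl) _.
  exact/same_pages_sym/same_pages_homotopic_right.
apply: collections_trans (collections_stabs A s) _.
apply: collections_trans (collections_tame AB) _.
exact/collections_sym/collections_stabs.
Qed.
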